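(* For each $n\ge4$ let $u=(u_{ij})$ be the fundamental corepresentation of $A_s(n)$ with Haar state $\int$, and for $1\le s\le n$ let $X_{s,n}=u_{11}+\cdots+u_{ss}$. (1) If $s=s(n)$ satisfies $1\le s\le n$ and $s/n\to0$ as $n\to\infty$, then $X_{s,n}$ is asymptotically a projection of trace $s/n$, in the sense that for every $k\ge1$, $\int X_{s,n}^k=\frac{s}{n}(1+o(1))$ as $n\to\infty$. (2) If $t\in(0,1]$ and $s=s(n)$ satisfies $1\le s\le n$ and $s=tn+o(n)$, then the law of $X_{s,n}$ converges in moments to the free Poisson law $\mu_t$ of parameter $t$: for every $k\ge1$, $\int X_{s,n}^k\to\sum_{p\in NC(k)}t^{|p|}=\int x^k\,d\mu_t(x)$ as $n\to\infty$.
   Context: A magic unitary is a square matrix over a C*-algebra whose entries are projections such that the entries of each row and of each column are mutually orthogonal and sum to $1$. $A_s(n)$ is the universal C*-algebra generated by $n^2$ elements $u_{ij}$ subject to the relations making $u=(u_{ij})$ a magic unitary; it is a compact quantum group with comultiplication $\Delta(u_{ij})=\sum_k u_{ik}\otimes u_{kj}$, and $u$ is its fundamental corepresentation. The Haar state $\int$ is the unique state $h$ with $(h\otimes \mathrm{id})\Delta=(\mathrm{id}\otimes h)\Delta=h(\cdot)1$. The law of a self-adjoint element $X$ is the probability measure on $\mathbb{R}$ whose $k$-th moment is $\int X^k$. $NC(k)$ is the set of non-crossing partitions of $\{1,\ldots,k\}$ and $|p|$ the number of blocks. For $t\in(0,1]$ the free Poisson (Marchenko–Pastur) law of parameter $t$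 is $\mu_t=(1-t)\delta_0+\frac{1}{2\pi x}\sqrt{4t-(x-1-t)^2}\,dx$ on $\{0\}\cup[(1-\sqrt t)^2,(1+\sqrt t)^2]$. *)

(* Defs.v *)
From HB Require Import structures.
From mathcomp Require Import all_boot all_order all_algebra.
From mathcomp Require Import complex.
From mathcomp Require Import all_classical all_reals all_analysis.
From mathcomp Require Import measurable_realfun.

Set Implicit Arguments.
Unset Strict Implicit.
Unset Printing Implicit Defensive.

Import Order.TTheory GRing.Theory Num.Theory.
Import numFieldNormedType.Exports.

Local Open Scope complex_scope.
Local Open Scope ring_scope.

(* Unital complex C*-algebras. The norm is an explicit real-valued field:
   the hierarchy has no join of (non-commutative) rings with normed modules,
   so [algType] and [completeNormedModType] cannot live on the same carrier. *)
HB.mixin Record isCStarAlgebra (R : realType) A of GRing.Algebra R[i] A := {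
  cnorm : A -> R ;
  star : A -> A ;
  cnorm0_eq0 : forall x : A, cnorm x = 0 -> x = 0 ;
  cnormD : forall x y : A, cnorm (x + y) <= cnorm x + cnorm y ;
  cnormZ : forall (c : R[i]) (x : A), (cnorm (c *: x))%:C = `|c| * (cnorm x)%:C ;
  cnormM : forall x y : A, cnorm (x * y) <= cnorm x * cnorm y ;
  cnorm_complete : forall x : nat -> A,
    (forall e : R, 0 < e -> exists N : nat, forall m n : nat,
       (N <= m)%N -> (N <= n)%N -> cnorm (x m - x n) < e) ->
    exists l : A, forall e : R, 0 < e -> exists N : nat, forall n : nat,
       (N <= n)%N -> cnorm (x n - l) < e ;
  starK : involutive star ;
  starD : {morph star : x y / x + y} ;
  starZ : forall (c : R[i]) (x : A), star (c *: x) = c^*%R *: star x ;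
  starM : forall x y : A, star (x * y) = star y * star x ;
  cnorm_star : forall x : A, cnorm (star x * x) = cnorm x ^+ 2
}.

#[short(type="cstarType")]
HB.structure Definition CStarAlgebra (R : realType) :=
  {A of isCStarAlgebra R A & GRing.Algebra R[i] A}.

Section QuantumPermutation.
Variable R : realType.
Implicit Types A B T : cstarType R.

Definition star_hom A B (f : A -> B) : Prop :=
  [/\ linear f, monoid_morphism f & forall x, f (star x) = star (f x)].

Definition is_state A (h : A -> R[i]) : Prop :=
  [/\ scalar h, forall x, 0 <= h (star x * x) & h 1 = 1].

Definition projection A (p : A) : Prop := star p = p /\ p * p = p.

Definition magic_unitary A n (u : 'M[A]_n) : Prop :=
  [/\ forall i j, projection (u i j),
      forall i j k, j != k -> u i j * u i k = 0,
      forall i j k, i != k -> u i j * u k j = 0,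
      forall i, \sum_j u i j = 1
    & forall j, \sum_i u i j = 1].

(* [A], with fundamental corepresentation [u], is the universal C*-algebra
   generated by the entries of an n x n magic unitary. *)
Definition is_As A n (u : 'M[A]_n) : Prop :=
  magic_unitary u /\
  forall B (v : 'M[B]_n), magic_unitary v ->
    exists! f : A -> B, star_hom f /\ forall i j, f (u i j) = v i j.

Definition bounded_op A B (L : A -> B) : Prop :=
  exists M : R, forall x, cnorm (L x) <= M * cnorm x.

(* [T] is a completion of the algebraic tensor product of [A] and [B] for some
   C*-norm: [tens] is bilinear and compatible with the *-algebra operations,
   the induced map from the algebraic tensor product is injective, and its
   range is dense. Both the minimal and the maximal tensor products qualify. *)
Definition is_cstar_tensor A B T (tens : A -> B -> T) : Prop :=
  [/\ (forall b, linear (tens^~ b)) /\ (forall a, linear (tens a)),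
      tens 1 1 = 1 /\
        (forall a b a' b', tens a b * tens a' b' = tens (a * a') (b * b')),
      forall a b, star (tens a b) = tens (star a) (star b),
      forall m (a : 'I_m -> A) (b : 'I_m -> B),
        (forall c : 'I_m -> R[i],
           \sum_i c i *: a i = 0 -> forall i, c i = 0) ->
        \sum_i tens (a i) (b i) = 0 -> forall i, b i = 0
    & forall (x : T) (e : R), 0 < e ->
        exists m (a : 'I_m -> A) (b : 'I_m -> B),
          cnorm (x - \sum_i tens (a i) (b i)) < e].

Definition is_comultiplication A T (tens : A -> A -> T) n (u : 'M[A]_n)
    (Delta : A -> T) : Prop :=
  star_hom Delta /\
  forall i j, Delta (u i j) = \sum_k tens (u i k) (u k j).

(* [h (x) id] and [id (x) h] as maps on the completed tensor product: the
   bounded linear extensions of their values on elementary tensors, unique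
   because elementary tensors span a dense subspace. *)
Definition is_slice_l A T (tens : A -> A -> T) (h : A -> R[i])
    (L : T -> A) : Prop :=
  [/\ linear L, bounded_op L & forall a b, L (tens a b) = h a *: b].

Definition is_slice_r A T (tens : A -> A -> T) (h : A -> R[i])
    (L : T -> A) : Prop :=
  [/\ linear L, bounded_op L & forall a b, L (tens a b) = h b *: a].

Definition is_haar_state A T (tens : A -> A -> T) (Delta : A -> T)
    (h : A -> R[i]) : Prop :=
  [/\ is_state h,
      exists2 L, is_slice_l tens h L & forall x, L (Delta x) = h x *: 1
    & exists2 L, is_slice_r tens h L & forall x, L (Delta x) = h x *: 1].

Definition truncated_trace A n (u : 'M[A]_n) (s : nat) : A :=
  \sum_(i < n | (i < s)%N) u i i.

End QuantumPermutation.

Definition noncrossing k (p : {set {set 'I_k}}) : bool :=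
  [forall B in p, forall C in p,
    forall a in B, forall b in C, forall c in B, forall d in C,
    [&& a < b, b < c & c < d]%N ==> (B == C)].

Definition NC k : {set {set {set 'I_k}}} :=
  [set p | finset.partition p [set: 'I_k] & noncrossing p]%SET.

Section FreePoisson.
Local Open Scope classical_set_scope.
Variable R : realType.
Local Notation leb := (@lebesgue_measure R).

Definition free_poisson_pdf (t x : R) : R :=
  if (1 - Num.sqrt t) ^+ 2 <= x <= (1 + Num.sqrt t) ^+ 2
  then Num.sqrt (4 * t - (x - 1 - t) ^+ 2) / (2 * pi * x) else 0.

Lemma free_poisson_pdf_ge0 t x : 0 <= free_poisson_pdf t x.
Proof.
rewrite /free_poisson_pdf; case: ifP => // /andP[x0 _].
by rewrite divr_ge0 ?sqrtr_ge0// !mulr_ge0 ?pi_ge0// (le_trans _ x0)// sqr_ge0.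
Qed.

Lemma measurable_invr : measurable_fun [set: R] (@GRing.inv R).
Proof.
rewrite (_ : @GRing.inv R =
    fun x => if x == 0 then 0 else x^-1); last first.
  by apply/funext => x; case: eqP => [->|//]; rewrite invr0.
apply: measurable_fun_if => //=.
  apply: (measurable_fun_bool true).
  rewrite setTI (_ : _ @^-1` _ = [set 0])//.
  by apply/seteqP; split=> x /= => [/eqP|->]; rewrite ?eqxx.
rewrite setTI (_ : _ @^-1` _ = [set x | x != 0]); last first.
  by apply/seteqP; split=> x /= => [/negbT|/negbTE].
apply: open_continuous_measurable_fun => //.
by apply/in_setP => x /= x0; exact: inv_continuous.
Qed.

Lemma measurable_free_poisson_pdf t :
  measurable_fun [set: R] (free_poisson_pdf t).
Proof.
apply: measurable_fun_ifT => //=.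
  by apply: measurable_and => //; exact: measurable_fun_ler.
apply: measurable_funM.
  apply: measurableT_comp.
    by apply: continuous_measurable_fun; exact: sqrt_continuous.
  apply: measurable_funB => //; apply: measurable_funX.
  by apply: measurable_funB => //; exact: measurable_funB.
apply: (measurableT_comp measurable_invr).
exact: measurable_funM.
Qed.

Definition free_poisson_ac (t : R) (U : set R) : \bar R :=
  (\int[leb]_(x in U) (free_poisson_pdf t x)%:E)%E.

Let ac0 t : free_poisson_ac t set0 = 0%E.
Proof. by rewrite /free_poisson_ac integral_set0. Qed.

Let ac_ge0 t U : (0 <= free_poisson_ac t U)%E.
Proof. by apply: integral_ge0 => x _; rewrite lee_fin free_poisson_pdf_ge0. Qed.

Let ac_sigma_additive t : semi_sigma_additive (free_poisson_ac t).
Proof.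
apply: (@semi_sigma_additive_nng_induced _ (measurableTypeR R) R leb) => [|x].
  by apply/measurable_EFinP; exact: measurable_free_poisson_pdf.
by rewrite lee_fin free_poisson_pdf_ge0.
Qed.

HB.instance Definition _ t := isMeasure.Build _ _ _ (free_poisson_ac t)
  (ac0 t) (ac_ge0 t) (@ac_sigma_additive t).

Lemma free_poisson_atom_ge0 (t : R) : 0 < t <= 1 -> 0 <= 1 - t.
Proof. by rewrite subr_ge0 => /andP[]. Qed.

Definition free_poisson (t : R) (ht : 0 < t <= 1) :
    {measure set R -> \bar R} :=
  measure_add (mscale (NngNum (free_poisson_atom_ge0 ht)) (dirac (0 : R)))
    (free_poisson_ac t).

End FreePoisson.

(* Main.v *)
Require Import Defs.
From HB Require Import structures.
From mathcomp Require Import all_boot all_order all_algebra.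
From mathcomp Require Import perm complex.
From mathcomp Require Import all_classical all_reals all_analysis.
From mathcomp Require Import measurable_realfun.
From mathcomp Require Import ring lra zify.

(* Pairing words of length k with words of length k, the matrix P of Haar
   integrals of monomials in the u_ij fixes the indicator vectors T_p of the
   words constant on the blocks of p, for p in NC(k): this only uses the magic
   relations. Conversely each column of P is fixed by u^(tensor k), hence, by
   universality, by v^(tensor k) for every magic unitary v over the 2 x 2 complex
   matrices. Permutation matrices, and one magic unitary made of two
   non-commuting 2 x 2 blocks, already force a fixed vector to be a combination
   of the T_p with p noncrossing as soon as n >= k + 2: the two blocks give
   symmetries g, h with ghgh = -1, which kills the coordinates at words with a
   crossing kernel. Hence
   int X_(s,n)^k = tr (G_n^-1 G_s), where G_m is the Gram matrix of the T_p over
   m letters. After scaling row p by n^(-|p|), G_n tends to the zeta matrix Z of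
   the refinement order (transposed) and G_s behaves like diag((s/n)^|p|) Z, so
   the trace is asymptotic to the sum of (s/n)^|p|.

   The noncrossing sums satisfy the first-return recurrence of Motzkin paths with
   weights 1 + t (level) and t (down); the moments of the free Poisson law count
   the same paths, by the Chebyshev recurrence after the substitution
   x = 1 + t + 2 sqrt(t) cos(theta). *)

Set Implicit Arguments.
Unset Strict Implicit.
Unset Printing Implicit Defensive.

Import Order.TTheory GRing.Theory Num.Theory.
Import numFieldNormedType.Exports.

Local Open Scope complex_scope.
Local Open Scope ring_scope.

(** * Noncrossing words and magic matrices *)

(** The obstacle is the upper bound on fixed vectors. It is obtained without describing
    intertwiners: the test representations need only detect crossings. Two extra letters are
    required because a word of length k may use k letters, and each of its two crossing blocks must
    be exchangeable with a letter that does not occur in the word. The entries of P are never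
    computed. Knowing that its columns lie in the span of the T_p and that it fixes the T_p gives
    G_n X = G_s for a matrix X whose trace is the moment. Invertibility of G_n is obtained only for
    large n, as a consequence of the invertibility of its scaled limit; since k is fixed, this is
    enough. Scaling rows and columns symmetrically by n^(-|p|/2) would make the limit of G_n the
    identity, but involves half-integer powers. Scaling rows alone leaves the triangular matrix Z in
    the limit, and the trace of a conjugate Z^-1 D Z does not see it. When s/n tends to 0 only the
    one-block partition counts at first order, and s may stay bounded, so this regime has its own
    estimate. *)

Section Words.
Variable L : eqType.
Implicit Types (a b : L) (w : seq L).

Definition nc_word w := forall a b, a != b -> ~~ subseq [:: a; b; a; b] w.

Lemma nc_word_subseq v w : subseq v w -> nc_word w -> nc_word v.
Proof.
by move=> vw ncw a b ab; apply: contra (ncw a b ab) => /subseq_trans; apply.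
Qed.

(* A letter occurring only once between two consecutive occurrences of another
   letter cannot occur elsewhere, by the noncrossing condition. *)
Lemma nc_word_reducible w : nc_word w -> w != [::] ->
  exists w1 a w2, w = w1 ++ a :: a :: w2 \/
    [/\ w = w1 ++ a :: w2, a \notin w1 & a \notin w2].
Proof.
have [m] := ubnP (size w); elim: m w => // m IH [//|a w] /=.
rewrite ltnS => wm nc _.
have [aw|aNw] := boolP (a \in w); last first.
  by exists [::], a, w; right.
rewrite -has_pred1 in aw.
case/split_find: aw wm nc => {w} _ x y /eqP -> /[!has_pred1] ax.
rewrite -cats1 -catA /= => wm nc.
have [x0|x0] := eqVneq x [::].
  by exists [::], a, y; left; rewrite x0.
have [||x1 [b [x2 [xE|[xE bx1 bx2]]]]] := IH x _ _ x0.
- by apply: leq_trans wm; rewrite size_cat /= -addSn leq_addr.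
- apply: nc_word_subseq nc; apply: subseq_trans (subseq_cons _ _).
  exact: prefix_subseq.
- by exists (a :: x1), b, (x2 ++ a :: y); left; rewrite xE /= -catA.
- have bx : b \in x by rewrite xE mem_cat inE eqxx orbT.
  have ba : b != a by apply: contraNneq ax => <-.
  exists (a :: x1), b, (x2 ++ a :: y); right; split.
  + by rewrite xE /= -catA.
  + by rewrite inE negb_or ba.
  + rewrite mem_cat inE !negb_or bx2 ba /=.
    rewrite eq_sym in ba; apply: contra (nc _ _ ba) => yb.
    rewrite /= eqxx.
    rewrite (_ : [:: b; a; b] = [:: b] ++ [:: a; b])//.
    apply: cat_subseq; first by rewrite sub1seq.
    by rewrite /= eqxx sub1seq.
Qed.
End Words.

Lemma subseq_map_inv (T U : eqType) (f : T -> U) (s : seq U) (t : seq T) :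
  subseq s (map f t) -> exists2 s', subseq s' t & s = map f s'.
Proof.
case/subseqP => m sm ->; exists (mask m t); last by rewrite map_mask.
exact: mask_subseq.
Qed.

Lemma map_eq_cat (T U : Type) (f : T -> U) (s : seq T) (w1 w2 : seq U) :
  map f s = w1 ++ w2 ->
  exists s1 s2, [/\ s = s1 ++ s2, map f s1 = w1 & map f s2 = w2].
Proof.
move=> sE; exists (take (size w1) s), (drop (size w1) s).
by rewrite cat_take_drop map_take map_drop sE take_size_cat// drop_size_cat.
Qed.

Section Resample.
Variables (L : finType) (n : nat).
Implicit Types f : {ffun L -> 'I_n}.

Definition upd f (a : L) (b : 'I_n) : {ffun L -> 'I_n} :=
  [ffun x => if x == a then b else f x].

Lemma upd_same f a b : upd f a b a = b.
Proof. by rewrite ffunE eqxx. Qed.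

Lemma upd_other f a b x : x != a -> upd f a b x = f x.
Proof. by rewrite ffunE => /negbTE ->. Qed.

(** Exchanging the value at [a] with the extra letter [b] is an involution of the pairs [(f, b)]. It
    turns the letter of one block into a separate summation variable, at the price of a factor
    [n]. *)
Lemma big_resample (T : Type) (idx : T) (op : Monoid.com_law idx)
    (F : {ffun L -> 'I_n} -> T) (a : L) :
  \big[op/idx]_f \big[op/idx]_(b < n) F f =
  \big[op/idx]_f \big[op/idx]_(b < n) F (upd f a b).
Proof.
pose g (z : {ffun L -> 'I_n} * 'I_n) := (upd z.1 a z.2, z.1 a).
have gK : involutive g.
  case=> f b; rewrite /g /= upd_same; congr pair.
  by apply/ffunP => x; rewrite !ffunE; case: eqP => [->|].
rewrite !pair_bigA /= [RHS](reindex_inj (inv_inj gK)) /=.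
apply: eq_bigr => -[f b] _ /=; congr F.
by apply/ffunP => x; rewrite !ffunE; case: eqP => [->|].
Qed.

Lemma sum_resample (V : nmodType) (F : {ffun L -> 'I_n} -> V) (a : L) :
  (\sum_f F f) *+ n = \sum_f \sum_(b < n) F (upd f a b).
Proof.
rewrite -big_resample -sumrMnl; apply: eq_bigr => f _.
by rewrite sumr_const card_ord.
Qed.
End Resample.

Section WordSums.
Variables (F : numFieldType) (A : algType F) (L : finType) (n : nat).
Hypothesis n0 : (0 < n)%N.

(* The two consequences of the magic relations that collapse a noncrossing
   word. They also hold for the identity matrix, so that a word sum over a
   magic unitary has the same value as over the identity. *)
Definition row_magic (u : 'I_n -> 'I_n -> A) :=
  (forall i i' b, u i b * u i' b = if i == i' then u i b else 0) /\
  (forall i, \sum_b u i b = 1).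

Definition word_sum (u : 'I_n -> 'I_n -> A) (s : seq ('I_n * L)) : A :=
  \sum_(f : {ffun L -> 'I_n}) \prod_(x <- s) u x.1 (f x.2).

Definition id_fun (i j : 'I_n) : A := (i == j)%:R.

Lemma row_magic_id : row_magic id_fun.
Proof.
split=> [i i' b|i].
  rewrite /id_fun; have [<-|ii'] := eqVneq i i'.
    by case: (i == b); rewrite ?mulr1 ?mulr0.
  by have [<-|] := eqVneq i b; rewrite ?mul0r// [i' == i]eq_sym (negbTE ii') mulr0.
by rewrite (bigD1 i) //= /id_fun eqxx big1 ?addr0 // => j /negbTE; rewrite eq_sym => ->.
Qed.

Lemma word_sum_merge u s1 i i' a s2 : row_magic u ->
  word_sum u (s1 ++ (i, a) :: (i', a) :: s2) =
  if i == i' then word_sum u (s1 ++ (i, a) :: s2) else 0.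
Proof.
move=> [um _]; rewrite /word_sum.
have [ii'|ii'] := eqVneq i i'; last first.
  apply: big1 => f _; rewrite big_cat !big_cons /= [u i _ * _]mulrA um.
  by rewrite (negbTE ii') mul0r mulr0.
apply: eq_bigr => f _; rewrite !big_cat !big_cons /= [u i _ * _]mulrA um.
by rewrite ii' eqxx.
Qed.

(** The relation [\sum_b u i b = 1] sums out the letter of [a]. The shorter word still ranges over
    functions defined at [a], hence the factor [n]. *)
Lemma word_sum_single u s1 i a s2 : row_magic u ->
  a \notin map snd s1 -> a \notin map snd s2 ->
  word_sum u (s1 ++ (i, a) :: s2) *+ n = word_sum u (s1 ++ s2).
Proof.
move=> [_ u1] as1 as2; rewrite /word_sum (sum_resample _ a).
apply: eq_bigr => f _.
have prod_upd s b : a \notin map snd s ->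
    \prod_(x <- s) u x.1 (upd f a b x.2) = \prod_(x <- s) u x.1 (f x.2).
  elim: s => [|x s IH] /=; first by rewrite !big_nil.
  by rewrite inE negb_or => /andP[ax /IH]; rewrite !big_cons => ->;
    rewrite upd_other // eq_sym.
transitivity (\sum_(b < n) (\prod_(x <- s1) u x.1 (f x.2) *
    u i b * \prod_(x <- s2) u x.1 (f x.2))).
  apply: eq_bigr => b _.
  by rewrite big_cat big_cons /= !prod_upd // upd_same mulrA.
by rewrite -big_distrl -big_distrr /= u1 mulr1 big_cat.
Qed.

(** Both sides undergo the same reductions down to the empty word: merging two adjacent occurrences
    of a letter, or summing out a letter met once. *)
Lemma word_sum_nc u s : row_magic u -> nc_word (map snd s) ->
  word_sum u s = word_sum id_fun s.
Proof.
move=> um; have [m] := ubnP (size s); elim: m s => // m IH s.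
rewrite ltnS => sm nc; have im := row_magic_id.
have [->|s0] := eqVneq s [::].
  by apply: eq_bigr => f _; rewrite !big_nil.
have w0 : map snd s != [::] by case: (s) s0.
have [w1 [a [w2 [wE|[wE a1 a2]]]]] := nc_word_reducible nc w0.
- have [s1 [t [sE w1E tE]]] := map_eq_cat wE.
  case: t sE tE => [|[i a1] [|[i' a2] s2]] sE //= [a1E a2E _]; subst a1 a2.
  rewrite sE !word_sum_merge //.
  case: ifP => // _; apply: IH.
    by move: sm; rewrite sE !size_cat /= !addnS.
  apply: nc_word_subseq nc; rewrite sE !map_cat /=.
  by apply: cat_subseq => //; apply: subseq_cons.
- have [s1 [t [sE w1E tE]]] := map_eq_cat wE.
  case: t sE tE => [|[i a'] s2] sE //= [aE w2E]; subst a'.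
  have ls : (size (s1 ++ s2) < m)%N.
    by move: sm; rewrite sE !size_cat /= !addnS.
  have nc' : nc_word (map snd (s1 ++ s2)).
    apply: nc_word_subseq nc; rewrite sE !map_cat /=.
    by apply: cat_subseq => //; apply: subseq_cons.
  have e : word_sum u s *+ n = word_sum id_fun s *+ n.
    by rewrite sE !word_sum_single ?w1E ?w2E // IH.
  have nn0 : n%:R != 0 :> F by rewrite pnatr_eq0 -lt0n.
  by apply: (scalerI nn0); rewrite !scaler_nat.
Qed.
End WordSums.

Lemma prod_eq_natr (A : pzSemiRingType) (I : finType) (T : eqType)
    (i j : {ffun I -> T}) :
  \prod_x ((i x == j x)%:R : A) = (i == j)%:R.
Proof.
rewrite -(big_morph (fun m : nat => m%:R : A) (natrM A) (erefl 1%:R)).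
congr (_%:R); have [<-|ij] := eqVneq i j.
  by apply: big1 => x _; rewrite eqxx.
have [x ixj] : exists x, i x != j x.
  apply/existsP; apply: contraNT ij => /existsPn h.
  by apply/eqP/ffunP => x; apply/eqP; have := h x; rewrite negbK.
by rewrite (bigD1 x) //= (negbTE ixj) mul0n.
Qed.

Section Partitions.
Variable k : nat.
Implicit Types (p q : {set {set 'I_k}}).

Definition finer p q : bool :=
  [forall x, forall y, (finset.pblock p x == finset.pblock p y) ==>
    (finset.pblock q x == finset.pblock q y)].

Lemma finerP p q :
  reflect (forall x y, finset.pblock p x = finset.pblock p y ->
      finset.pblock q x = finset.pblock q y)
    (finer p q).
Proof.
apply: (iffP 'forall_forallP) => [h x y /eqP xy|h x y].
  by apply/eqP; move: (h x y); rewrite xy.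
by apply/implyP => /eqP/h ->.
Qed.

Section Blocks.
Variable p : {set {set 'I_k}}.
Hypothesis pP : finset.partition p [set: 'I_k].

Lemma mem_cover_part x : x \in finset.cover p.
Proof. by rewrite (finset.cover_partition pP) inE. Qed.

Lemma mem_pblock_part x : x \in finset.pblock p x.
Proof. by rewrite finset.mem_pblock mem_cover_part. Qed.

Lemma pblock_in x : finset.pblock p x \in p.
Proof. exact: finset.pblock_mem (mem_cover_part x). Qed.

Lemma pblock_of B x : B \in p -> x \in B -> finset.pblock p x = B.
Proof. by apply: def_pblock; case/and3P: pP. Qed.

Lemma block_inhabited B : B \in p -> exists x, x \in B.
Proof.
move=> Bp; apply/finset.set0Pn; apply: contraTneq Bp => ->.
by case/and3P: pP.
Qed.

Lemma same_block x y : (finset.pblock p x == finset.pblock p y) = (y \in finset.pblock p x).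
Proof. by apply: eq_pblock; [case/and3P: pP | exact: mem_cover_part]. Qed.
End Blocks.

Lemma finer_refl p : finer p p. Proof. by apply/finerP. Qed.

Lemma finer_anti p q : finset.partition p [set: 'I_k] ->
  finset.partition q [set: 'I_k] -> finer p q -> finer q p -> p = q.
Proof.
have sub p' q' : finset.partition p' [set: 'I_k] ->
    finset.partition q' [set: 'I_k] ->
    (forall x, finset.pblock p' x = finset.pblock q' x) -> p' \subset q'.
  move=> p'P q'P pq; apply/fintype.subsetP => B Bp.
  have [x xB] := block_inhabited p'P Bp.
  by rewrite -(pblock_of p'P Bp xB) pq pblock_in.
move=> pP qP /finerP pq /finerP qp.
have pbE x : finset.pblock p x = finset.pblock q x.
  apply/finset.setP => y; rewrite -!same_block //.
  by apply/eqP/eqP; [apply: pq|apply: qp].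
by apply/eqP; rewrite finset.eqEsubset !sub.
Qed.

Lemma noncrossingP p : finset.partition p [set: 'I_k] ->
  reflect (forall a b c d : 'I_k, (a < b)%N -> (b < c)%N -> (c < d)%N ->
    finset.pblock p a = finset.pblock p c -> finset.pblock p b = finset.pblock p d ->
    finset.pblock p a = finset.pblock p b)
  (noncrossing p).
Proof.
move=> pP; apply: (iffP idP).
  move=> /forallP h a b c d ab bc cd ac bd.
  have := h (finset.pblock p a); rewrite pblock_in //= => /forallP/(_ (finset.pblock p b)).
  rewrite pblock_in //= => /forallP/(_ a); rewrite mem_pblock_part //=.
  move=> /forallP/(_ b); rewrite mem_pblock_part //=.
  move=> /forallP/(_ c); rewrite -same_block // ac eqxx /=.
  move=> /forallP/(_ d); rewrite -same_block // bd eqxx /= ab bc cd /=.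
  by move/eqP.
move=> h; apply/forallP => B; apply/implyP => Bp.
apply/forallP => C; apply/implyP => Cp.
apply/forallP => a; apply/implyP => aB.
apply/forallP => b; apply/implyP => bC.
apply/forallP => c; apply/implyP => cB.
apply/forallP => d; apply/implyP => dC.
apply/implyP => /and3P[ab bc cd]; apply/eqP.
rewrite -(pblock_of pP Bp aB) -(pblock_of pP Cp bC).
apply: (h a b c d) => //.
  by rewrite (pblock_of pP Bp aB) (pblock_of pP Bp cB).
by rewrite (pblock_of pP Cp bC) (pblock_of pP Cp dC).
Qed.

Section Delta.
Variables (n : nat) (p : {set {set 'I_k}}).
Hypothesis pP : finset.partition p [set: 'I_k].

Definition constant_on q (j : {ffun 'I_k -> 'I_n}) : bool :=
  [forall x, forall y, (finset.pblock q x == finset.pblock q y) ==> (j x == j y)].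

Lemma constant_onP q (j : {ffun 'I_k -> 'I_n}) :
  reflect (forall x y, finset.pblock q x = finset.pblock q y -> j x = j y) (constant_on q j).
Proof.
apply: (iffP 'forall_forallP) => [h x y /eqP xy|h x y].
  by apply/eqP; move: (h x y); rewrite xy.
by apply/implyP => /eqP/h ->.
Qed.

Local Notation blocks := {B : {set 'I_k} | B \in p}.

Definition label (x : 'I_k) : blocks := Sub (finset.pblock p x) (pblock_in pP x).

Lemma label_surj (B : blocks) : exists x, label x = B.
Proof.
have [x xB] := block_inhabited pP (valP B).
by exists x; apply: val_inj; rewrite /= (pblock_of pP (valP B) xB).
Qed.

Definition pull (f : {ffun blocks -> 'I_n}) : {ffun 'I_k -> 'I_n} :=
  [ffun x => f (label x)].

Lemma pull_inj : injective pull.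
Proof.
move=> f g /ffunP fg; apply/ffunP => B.
by have [x <-] := label_surj B; have := fg x; rewrite !ffunE.
Qed.

(** Such words are the functions on the set of blocks, so one letter is chosen freely for each
    block; counting and resampling are done on that side. *)
Lemma constant_on_pull (j : {ffun 'I_k -> 'I_n}) :
  constant_on p j = (j \in [set pull f | f : {ffun blocks -> 'I_n}]%SET).
Proof.
apply/constant_onP/imsetP => [jp|[f _ ->] x y xy]; last first.
  by rewrite !ffunE; congr (f _); apply: val_inj.
have /fin_all_exists [s sP] : forall B : blocks, exists x, label x = B.
  exact: label_surj.
exists [ffun B => j (s B)] => //; apply/ffunP => x; rewrite !ffunE.
by apply: jp; have := congr1 val (sP (label x)).
Qed.

Lemma big_constant_on (T : Type) (idx : T) (op : Monoid.com_law idx)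
    (G : {ffun 'I_k -> 'I_n} -> T) :
  \big[op/idx]_(j | constant_on p j) G j =
  \big[op/idx]_(f : {ffun blocks -> 'I_n}) G (pull f).
Proof.
under eq_bigl => j do rewrite constant_on_pull.
by rewrite big_imset //= => f g _ _; apply: pull_inj.
Qed.

Lemma card_constant_on :
  (\sum_(j : {ffun 'I_k -> 'I_n} | constant_on p j) 1 = n ^ #|p|)%N.
Proof. by rewrite big_constant_on sum1_card card_ffun card_ord card_sig. Qed.

Lemma card_constant_on_finer q : finer q p ->
  (\sum_(j : {ffun 'I_k -> 'I_n} | constant_on p j && constant_on q j) 1
   = n ^ #|p|)%N.
Proof.
move=> /finerP qp; rewrite -card_constant_on; apply: eq_bigl => j.
rewrite andb_idr // => /constant_onP jp.
by apply/constant_onP => x y /qp/jp.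
Qed.

(** Some [x], [y] share a block of [q] but not of [p]. Constancy on [q] ties the letters of two
    distinct blocks of [p], so one of the [#|p|] free choices is lost. *)
Lemma card_constant_on2 q : ~~ finer q p ->
  ((\sum_(j : {ffun 'I_k -> 'I_n} | constant_on p j && constant_on q j) 1) * n
   <= n ^ #|p|)%N.
Proof.
case/forallPn => x /forallPn[y]; rewrite negb_imply => /andP[/eqP qxy pxy].
rewrite big_mkcondr /= big_constant_on.
rewrite big_distrl /=.
under eq_bigr => f _ do
  rewrite mulnC -[X in (X * _)%N]card_ord -sum_nat_const.
rewrite (big_resample _ _ (label x)) /=.
have -> : (n ^ #|p| = \sum_(f : {ffun blocks -> 'I_n}) 1)%N.
  by rewrite sum1_card card_ffun card_ord card_sig.
apply: leq_sum => f _.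
apply: (@leq_trans (\sum_(b < n) (b == f (label y)))); last first.
  by rewrite (bigD1 (f (label y))) //= eqxx big1 // => b /negbTE ->.
apply: leq_sum => b _; case: ifP => // /constant_onP/(_ x y qxy).
rewrite !ffunE eqxx -val_eqE /= eq_sym (negbTE pxy) => ->.
by rewrite eqxx.
Qed.

Lemma nc_word_label : noncrossing p -> nc_word (map label (enum 'I_k)).
Proof.
move=> /(noncrossingP pP) nc a b ab; apply/negP => /subseq_map_inv[s ss].
case: s ss => [|x1 [|x2 [|x3 [|x4 []]]]] //= ss [a1 b2 a3 b4].
have : sorted ltn (map val [:: x1; x2; x3; x4]).
  apply: (@subseq_sorted _ ltn ltn_trans _ (map val (enum 'I_k))).
    exact: map_subseq.
  by rewrite val_enum_ord iota_ltn_sorted.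
rewrite /= => /and4P[x12 x23 x34 _].
move/eqP: ab; apply; rewrite a1 b2; apply: val_inj => /=.
apply: (nc x1 x2 x3 x4) => //.
  by have := congr1 val (etrans (esym a1) a3).
by have := congr1 val (etrans (esym b2) b4).
Qed.

(** The invariance of T_p under u^(tensor k): the word sum has the value that it takes over the
    identity matrix, where every monomial is a Kronecker delta. *)
Lemma sum_noncrossing_magic (F : numFieldType) (A : algType F)
    (u : 'I_n -> 'I_n -> A) (i : {ffun 'I_k -> 'I_n}) :
  (0 < n)%N -> row_magic u -> noncrossing p ->
  \sum_(j | constant_on p j) \prod_x u (i x) (j x) = (constant_on p i)%:R.
Proof.
move=> n0 um nc.
have wordE v : \sum_(j | constant_on p j) \prod_x v (i x) (j x) =
    word_sum v [seq (i x, label x) | x <- enum 'I_k] :> A.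
  rewrite big_constant_on; apply: eq_bigr => f _.
  rewrite big_map (_ : enum 'I_k = index_enum 'I_k); last first.
    by rewrite enumT /index_enum unlock.
  by apply: eq_bigr => x _; rewrite !ffunE.
rewrite wordE word_sum_nc //; last first.
  by rewrite -map_comp; apply: nc_word_label.
rewrite -wordE.
under eq_bigr => j _ do rewrite prod_eq_natr.
have [ip|iNp] := boolP (constant_on p i).
  rewrite (bigD1 i) //= eqxx big1 ?addr0 // => j /andP[_ ji].
  by rewrite eq_sym (negbTE ji).
apply: big1 => j jp; case: eqP => // ij.
by move: iNp; rewrite ij jp.
Qed.
End Delta.
End Partitions.

(** * Vectors fixed by magic unitaries *)

Section Zeta.
Variable k : nat.
Implicit Types (p q : {set {set 'I_k}}).

(** A rank that strictly increases under coarsening. It is the measure of the inductions along the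
    refinement order. *)
Definition kernel_pairs p : nat :=
  \sum_(x < k) \sum_(y < k) (finset.pblock p x == finset.pblock p y).

Lemma kernel_pairs_lt p q : finset.partition p [set: 'I_k] ->
  finset.partition q [set: 'I_k] -> finer p q -> p != q ->
  (kernel_pairs p < kernel_pairs q)%N.
Proof.
move=> pP qP pq neq.
have : ~~ finer q p by apply: contraNN neq => qp; apply/eqP/finer_anti.
case/forallPn => x /forallPn[y]; rewrite negb_imply => /andP[qxy pxy].
have le z t : ((finset.pblock p z == finset.pblock p t) <=
    (finset.pblock q z == finset.pblock q t))%N.
  have /finerP/(_ z t) := pq.
  by case: eqP => // e /(_ e) ->; rewrite eqxx.
rewrite /kernel_pairs (bigD1 x) //= [ltnRHS](bigD1 x) //= -addSn leq_add //.
  rewrite (bigD1 y) //= [ltnRHS](bigD1 y) //= -addSn leq_add //.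
    by rewrite (negbTE pxy) qxy.
  by apply: leq_sum.
by apply: leq_sum => z _; apply: leq_sum.
Qed.

Definition zeta_mx (F : pzSemiRingType) : 'M[F]_#|NC k| :=
  \matrix_(i, j) (finer (enum_val i) (enum_val j))%:R.

Lemma NC_partition p : p \in NC k -> finset.partition p [set: 'I_k].
Proof. by rewrite inE => /andP[]. Qed.

Lemma NC_noncrossing p : p \in NC k -> noncrossing p.
Proof. by rewrite inE => /andP[]. Qed.

(** Triangularity without sorting the index set: a row vector killed by the zeta matrix vanishes at
    [j] as soon as it vanishes at all strictly finer partitions. *)
Lemma zeta_mx_unit (F : fieldType) : zeta_mx F \in unitmx.
Proof.
rewrite unitmxE unitfE; apply/negP => /det0P[v v0 vZ].
move/eqP: v0; apply; apply/rowP => j; rewrite mxE.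
have [m] := ubnP (kernel_pairs (enum_val j)); elim: m j => // m IH j jm.
have := congr1 (fun M : 'rV_ _ => M 0 j) vZ; rewrite !mxE.
rewrite (bigD1 j) //= !mxE finer_refl mulr1 big1 ?addr0 // => i ij.
rewrite !mxE; have [pij|_] := boolP (finer _ _); last by rewrite mulr0.
rewrite ltnS in jm; rewrite IH ?mul0r //; apply: leq_trans jm; apply: kernel_pairs_lt => //.
- exact/NC_partition/enum_valP.
- exact/NC_partition/enum_valP.
- by apply: contraNneq ij => /enum_val_inj ->.
Qed.

Section Kernel.
Variable n : nat.
Implicit Types j : {ffun 'I_k -> 'I_n}.

Definition ker_part j : {set {set 'I_k}} := preim_partition j [set: 'I_k].

Lemma ker_partP j : finset.partition (ker_part j) [set: 'I_k].
Proof. exact: preim_partitionP. Qed.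

Lemma pblock_ker j x y :
  (finset.pblock (ker_part j) x == finset.pblock (ker_part j) y) = (j x == j y).
Proof.
rewrite (same_block (ker_partP j)) /ker_part /preim_partition.
rewrite pblock_equivalence_partition ?inE //.
by split=> // /eqP ->.
Qed.

Lemma constant_on_ker p j : constant_on p j = finer p (ker_part j).
Proof. by apply: eq_forallb => x; apply: eq_forallb => y; rewrite pblock_ker. Qed.

Hypothesis kn : (k <= n)%N.

(** A word whose kernel is exactly [p]: the picked point depends only on the block, and the default
    is not reached because blocks contain their points. *)
Definition rep_fun p : {ffun 'I_k -> 'I_n} :=
  [ffun x => widen_ord kn (odflt x [pick y in finset.pblock p x])].

Lemma rep_fun_eq p x y : finset.partition p [set: 'I_k] ->
  (rep_fun p x == rep_fun p y) = (finset.pblock p x == finset.pblock p y).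
Proof.
move=> pP; rewrite !ffunE -val_eqE /=.
have rep z : finset.pblock p (odflt z [pick t in finset.pblock p z]) =
    finset.pblock p z.
  case: pickP => [t|//] /= tz; apply/esym/eqP.
  by rewrite (same_block pP).
apply/eqP/eqP => [e|e].
  by rewrite -(rep x) -(rep y); congr (finset.pblock p _); apply: val_inj.
rewrite e; case: pickP => // /(_ y).
by rewrite mem_pblock_part.
Qed.

End Kernel.
End Zeta.

Section Flip.
Variables (F : numFieldType) (B : algType F) (k n : nat).
Implicit Types xi : {ffun 'I_k -> 'I_n} -> F.

(** On a pair [{i, sigma i}] this is the block with [p] on the diagonal and [1 - p] off it. Taking
    [p = 0] gives the permutation matrix of [sigma], so a single family contains both kinds of
    test. *)
Definition flip_mx (sigma : 'I_n -> 'I_n) (p : 'I_n -> B) (i j : 'I_n) : B :=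
  p i *+ (i == j) + (1 - p i) *+ (sigma i == j).

Definition fixed_vec (v : 'I_n -> 'I_n -> B) xi :=
  forall i : {ffun 'I_k -> 'I_n}, \sum_j xi j *: \prod_x v (i x) (j x) = (xi i)%:A.

Section FlipMagic.
Variables (sigma : 'I_n -> 'I_n) (p : 'I_n -> B).
Hypotheses (sigmaK : involutive sigma) (pp : forall i, p i * p i = p i)
  (psigma : forall i, p (sigma i) = p i).

Lemma flip_mx_sym i j : flip_mx sigma p i j = flip_mx sigma p j i.
Proof.
rewrite /flip_mx [i == j]eq_sym; have [->//|ji] := eqVneq j i.
have -> : (sigma j == i) = (sigma i == j).
  by apply/eqP/eqP => <-; rewrite sigmaK.
by have [<-|_] := eqVneq (sigma i) j; rewrite ?psigma.
Qed.

Lemma flip_mx_idem i j : flip_mx sigma p i j * flip_mx sigma p i j = flip_mx sigma p i j.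
Proof.
rewrite /flip_mx; case: eqP => _; case: eqP => _; rewrite ?mulr0n ?mulr1n ?addr0 ?add0r ?mulr0 //.
- by rewrite addrC subrK mulr1.
- by rewrite mulrBr mulr1 mulrBl mul1r pp subrr subr0.
Qed.

Lemma flip_mx_row_orth i j l : j != l ->
  flip_mx sigma p i j * flip_mx sigma p i l = 0.
Proof.
have p1 : p i * (1 - p i) = 0 by rewrite mulrBr mulr1 pp subrr.
have p2 : (1 - p i) * p i = 0 by rewrite mulrBl mul1r pp subrr.
move=> jl; rewrite /flip_mx.
have [ij|_] := eqVneq i j; have [sj|_] := eqVneq (sigma i) j;
have [il|_] := eqVneq i l; have [sl|_] := eqVneq (sigma i) l;
 rewrite ?mulr0n ?mulr1n ?addr0 ?add0r ?mulr0 ?mul0r //.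
all: by exfalso; move/eqP: jl; apply; congruence.
Qed.

Lemma flip_mx_row_sum i : \sum_j flip_mx sigma p i j = 1.
Proof.
rewrite /flip_mx big_split /= (bigD1 i) //= eqxx big1 ?addr0; last first.
  by move=> j /negbTE; rewrite eq_sym => ->.
rewrite (bigD1 (sigma i)) //= eqxx big1 ?addr0; last first.
  by move=> j /negbTE; rewrite eq_sym => ->.
by rewrite !mulr1n addrC subrK.
Qed.

Lemma flip_row_magic : row_magic (flip_mx sigma p).
Proof.
split=> [i i' b|i]; last exact: flip_mx_row_sum.
case: eqP => [<-|/eqP ii']; first exact: flip_mx_idem.
by rewrite ![flip_mx _ _ _ b]flip_mx_sym flip_mx_row_orth.
Qed.
End FlipMagic.
End Flip.

Lemma prod_sorted4 (M : pzSemiRingType) k (g : 'I_k -> M) (a b c d : 'I_k) :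
  (a < b)%N -> (b < c)%N -> (c < d)%N ->
  (forall x, x \notin [:: a; b; c; d] -> g x = 1) ->
  \prod_x g x = g a * (g b * (g c * g d)).
Proof.
move=> ab bc cd g1.
transitivity (\prod_(x <- enum 'I_k | x \in [:: a; b; c; d]) g x).
  rewrite [RHS]big_mkcond /= (_ : enum 'I_k = index_enum 'I_k); last first.
    by rewrite enumT /index_enum unlock.
  by apply: eq_bigr => x _; case: ifPn => // /g1.
rewrite -big_filter (_ : seq.filter _ _ = [:: a; b; c; d]); last first.
  apply: (@irr_sorted_eq _ (fun x y : 'I_k => x < y)%N).
  - by move=> y x z; apply: ltn_trans.
  - by move=> x; rewrite /= ltnn.
  - apply: sorted_filter; first by move=> y x z; apply: ltn_trans.
    have := iota_ltn_sorted 0 k; rewrite -val_enum_ord.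
    by rewrite sorted_map.
  - by rewrite /= ab bc cd.
  - by move=> x; rewrite mem_filter mem_enum andbT.
by rewrite !big_cons big_nil mulr1.
Qed.

Section FixedVectors.
Variables (F : numFieldType) (B : algType F) (k n : nat).
Implicit Types xi : {ffun 'I_k -> 'I_n} -> F.
Implicit Types i j : {ffun 'I_k -> 'I_n}.

Lemma fixed_vec_tperm xi (a b : 'I_n) :
  fixed_vec (flip_mx (tperm a b) (fun=> 0 : B)) xi ->
  forall i, xi [ffun x => tperm a b (i x)] = xi i.
Proof.
move=> fx i; have := fx i.
set si := [ffun x => _].
have vE j : \prod_x flip_mx (tperm a b) (fun=> 0 : B) (i x) (j x) = (si == j)%:R.
  rewrite -prod_eq_natr; apply: eq_bigr => x _.
  by rewrite /flip_mx mul0rn add0r subr0 /si ffunE.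
under eq_bigr => j _ do rewrite vE.
rewrite (bigD1 si) //= eqxx big1 ?addr0; last first.
  by move=> j /negbTE; rewrite eq_sym => ->; rewrite scaler0.
by move/(fmorph_inj (in_alg B)).
Qed.

Definition tperm_inv xi :=
  forall (a b : 'I_n) i, xi [ffun x => tperm a b (i x)] = xi i.

(* The transposition of [i x] and [j x] makes [i] agree with [j] at one more
   point, because equal kernels keep the points of agreement untouched. *)
Lemma tperm_inv_kernel xi i j : tperm_inv xi ->
  (forall x y, (i x == i y) = (j x == j y)) -> xi i = xi j.
Proof.
move=> inv; have [m] := ubnP (\sum_(x < k) (i x != j x)).
elim: m i => // m IH i im ij.
have [/existsP[x xij]|/existsPn h] := boolP [exists x, i x != j x]; last first.
  by congr xi; apply/ffunP => x; apply/eqP; have := h x; rewrite negbK.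
rewrite -(inv (i x) (j x)); apply: IH; last first.
  by move=> y z; rewrite !ffunE (inj_eq perm_inj) ij.
rewrite ltnS in im; apply: leq_trans im.
rewrite (bigD1 x) //= [ltnRHS](bigD1 x) //= ffunE tpermL eqxx xij /= add0n add1n ltnS.
apply: leq_sum => y yx; rewrite ffunE.
have [e|_] := eqVneq (i y) (j y); last exact: leq_b1.
rewrite /= leqn0 eqb0 negbK.
rewrite tpermD ?e //.
  by rewrite -e ij; apply: contra_neq xij => jxy; apply/eqP; move: (ij x y);
    rewrite jxy eqxx => /eqP ->; rewrite e.
by rewrite -ij; apply: contra_neq xij => ixy; rewrite ixy e; apply/eqP; rewrite -ij ixy.
Qed.

Section Crossing.
Variables (P Q : B).
Let G := P *+ 2 - 1.
Let H := Q *+ 2 - 1.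
Hypothesis GHGH : G * (H * (G * H)) = -1.
Variables (xi : {ffun 'I_k -> 'I_n} -> F) (j0 : {ffun 'I_k -> 'I_n}).
Variables (a b c d : 'I_k) (b2 c2 : 'I_n).
Hypotheses (ab : (a < b)%N) (bc : (b < c)%N) (cd : (c < d)%N)
  (ac : j0 a = j0 c) (bd : j0 b = j0 d) (nab : j0 a != j0 b)
  (fb : forall x, j0 x != b2) (fc : forall x, j0 x != c2) (bc2 : b2 != c2).
Let b1 := j0 a.
Let c1 := j0 b.
Definition cross_flip (y : 'I_n) : 'I_n := tperm b1 b2 (tperm c1 c2 y).
(** The value [Q] away from the four moved letters is harmless: at a fixed point of the flip the two
    terms of [flip_mx] add up to 1. *)
Definition cross_proj (y : 'I_n) : B := if y \in [:: b1; b2] then P else Q.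
Local Notation sigma := cross_flip.
Local Notation p := cross_proj.

Lemma cross_flipE y : sigma y = if y == b1 then b2 else if y == b2 then b1
  else if y == c1 then c2 else if y == c2 then c1 else y.
Proof.
have nb12 : b1 != b2 := fb a.
have nc12 : c1 != c2 := fc b.
have nbc12 : b1 != c2 := fc a.
have ncb12 : c1 != b2 := fb b.
rewrite /cross_flip; case: (tpermP c1 c2 y) => [->|->|/eqP yc1 /eqP yc2].
- by rewrite tpermD // !eqxx [c1 == b1]eq_sym (negbTE nab) (negbTE ncb12).
- rewrite tpermD ?[b2 == _]eq_sym // !eqxx [c2 == b1]eq_sym (negbTE nbc12).
  by rewrite [c2 == b2]eq_sym (negbTE bc2) [c2 == c1]eq_sym (negbTE nc12).
rewrite (negbTE yc1) (negbTE yc2).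
case: (tpermP b1 b2 y) => [->|->|/eqP yb1 /eqP yb2]; rewrite ?eqxx //.
  by rewrite [b2 == b1]eq_sym (negbTE nb12).
by rewrite (negbTE yb1) (negbTE yb2).
Qed.

Lemma cross_flipK : involutive sigma.
Proof.
have nb12 : (b2 == b1) = false by rewrite eq_sym; apply/negbTE/fb.
have nc12 : (c2 == c1) = false by rewrite eq_sym; apply/negbTE/fc.
have nbc12 : (c2 == b1) = false by rewrite eq_sym; apply/negbTE/fc.
have ncb12 : (c1 == b2) = false by apply/negbTE/fb.
have nbc : (c1 == b1) = false by rewrite eq_sym; apply/negbTE.
have nbc2 : (c2 == b2) = false by rewrite eq_sym; apply/negbTE.
move=> y; rewrite !cross_flipE.
case: (eqVneq y b1) => [->|yb1]; first by rewrite nb12 eqxx.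
case: (eqVneq y b2) => [->|yb2]; first by rewrite eqxx.
case: (eqVneq y c1) => [->|yc1]; first by rewrite nbc12 nbc2 nc12 eqxx.
case: (eqVneq y c2) => [->|yc2]; first by rewrite nbc ncb12 eqxx.
by rewrite (negbTE yb1) (negbTE yb2) (negbTE yc1) (negbTE yc2).
Qed.

Lemma cross_proj_flip y : p (sigma y) = p y.
Proof.
have nbc12 : (c2 == b1) = false by rewrite eq_sym; apply/negbTE/fc.
have ncb12 : (c1 == b2) = false by apply/negbTE/fb.
have nbc : (c1 == b1) = false by rewrite eq_sym; apply/negbTE.
have nbc2 : (c2 == b2) = false by rewrite eq_sym; apply/negbTE.
rewrite /cross_proj !inE cross_flipE.
have [yb1|yb1] := eqVneq y b1; first by rewrite ?yb1 eqxx orbT.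
have [yb2|yb2] := eqVneq y b2; first by rewrite ?yb2 eqxx.
have [yc1|yc1] := eqVneq y c1; first by rewrite ?yc1 nbc12 nbc2.
have [yc2|yc2] := eqVneq y c2; first by rewrite ?yc2 nbc ncb12.
by rewrite (negbTE yb1) (negbTE yb2).
Qed.

(* The flip acts on the coordinate vectors [e_(b1) - e_(b2)] and
   [e_(c1) - e_(c2)] as the symmetries [G] and [H]. Pairing [xi] with the
   tensor having these vectors at [a, c] and [b, d], and the invariant vectors
   [e_y + e_(sigma y)] or [e_y] elsewhere, multiplies it by [GHGH = -1]. The
   pairing only involves [j0] and words with a strictly finer kernel. *)
Lemma crossing_vanish : fixed_vec (flip_mx sigma p) xi -> tperm_inv xi ->
  (forall j, (forall x y, j x = j y -> j0 x = j0 y) ->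
     (exists x y, j0 x = j0 y /\ j x <> j y) -> xi j = 0) ->
  xi j0 = 0.
Proof.
move=> fx inv IH.
pose S := [:: a; b; c; d].
pose w x y : F := if y == j0 x then 1 else
  if y == sigma (j0 x) then (if x \in S then -1 else 1) else 0.
pose g x : B := if x \in [:: a; c] then G else if x \in [:: b; d] then H else 1.
have ba : (b == a) = false by rewrite -val_eqE gtn_eqF.
have bcF : (b == c) = false by rewrite -val_eqE ltn_eqF.
have da : (d == a) = false by rewrite -val_eqE gtn_eqF // (ltn_trans ab) // (ltn_trans bc).
have dc : (d == c) = false by rewrite -val_eqE gtn_eqF.
have ca : (c == a) = false by rewrite -val_eqE gtn_eqF // (ltn_trans ab).
have db : (d == b) = false by rewrite -val_eqE gtn_eqF // (ltn_trans bc).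
have jS x : x \in S -> j0 x = if x \in [:: a; c] then b1 else c1.
  rewrite !inE => /or4P[] /eqP ->; rewrite ?eqxx ?orbT //.
  - by rewrite ba bcF.
  - by rewrite da dc -bd.
have nb12 : b1 != b2 := fb a.
have nc12 : c1 != c2 := fc b.
have sb : sigma b1 = b2 by rewrite cross_flipE eqxx.
have sc : sigma c1 = c2.
  by rewrite cross_flipE [c1 == b1]eq_sym (negbTE nab) (negbTE (fb b : c1 != b2)) eqxx.
have pb : p b1 = P by rewrite /cross_proj inE eqxx.
have pc : p c1 = Q.
  by rewrite /cross_proj !inE [c1 == b1]eq_sym (negbTE nab) (negbTE (fb b : c1 != b2)).
have wv x z : \sum_y w x y *: flip_mx sigma p y z = w x z *: g x.
  have [sx|sx] := eqVneq (sigma (j0 x)) (j0 x).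
    have xS : x \notin S.
      apply/negP => /jS jx; move/eqP: sx; rewrite jx.
      by case: ifP => _; rewrite ?sb ?sc 1?eq_sym ?(negbTE nb12) ?(negbTE nc12).
    rewrite (bigD1 (j0 x)) //= big1 ?addr0; last first.
      by move=> y /negbTE yj; rewrite /w sx yj scale0r.
    rewrite /w eqxx scale1r /flip_mx sx -mulrnDl addrC subrK.
    have -> : g x = 1.
      move: xS; rewrite /g !inE !negb_or => /and4P[xa xb xc xd].
      by rewrite (negbTE xa) (negbTE xb) (negbTE xc) (negbTE xd).
    rewrite ?sx [z == _]eq_sym; case: eqVneq => _;
      by rewrite ?scale1r ?scale0r ?mulr0n.
  rewrite (bigD1 (j0 x)) //= (bigD1 (sigma (j0 x))) //= big1 ?addr0; last first.
    by move=> y /andP[/negbTE yj /negbTE ys]; rewrite /w yj ys scale0r.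
  rewrite /w eqxx (negbTE sx) eqxx scale1r /flip_mx cross_flipK cross_proj_flip.
  rewrite ![z == _]eq_sym.
  have [xS|xS] := boolP (x \in S).
    have -> : g x = p (j0 x) *+ 2 - 1.
      rewrite /g jS //; move: xS; rewrite !inE.
      have [->|_] := eqVneq x a; first by rewrite pb.
      have [->|_] := eqVneq x c; first by rewrite orbT pb.
      by rewrite orbF /= => ->; rewrite pc.
    have [<-|jz] := eqVneq (j0 x) z;
      rewrite ?(negbTE sx) ?mulr0n ?addr0 ?add0r ?mulr1n ?scale1r ?scaleN1r.
      by rewrite opprB addrA mulr2n.
    have [sz|sz] := eqVneq (sigma (j0 x)) z;
      rewrite ?mulr0n ?addr0 ?add0r ?mulr1n ?scale0r ?oppr0 //.
    by rewrite scaleN1r opprB mulr2n opprD addrA.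
  have -> : g x = 1.
    move: xS; rewrite /g !inE !negb_or => /and4P[xa xb xc xd].
    by rewrite (negbTE xa) (negbTE xb) (negbTE xc) (negbTE xd).
  rewrite scale1r; have [<-|jz] := eqVneq (j0 x) z.
    by rewrite (negbTE sx) ?mulr0n ?addr0 ?add0r ?mulr1n ?scale1r addrC subrK.
  have [sz|sz] := eqVneq (sigma (j0 x)) z;
      rewrite ?mulr0n ?addr0 ?add0r ?mulr1n ?scale1r ?scale0r //.
  by rewrite subrK.
have prod_g : \prod_x g x = -1.
  rewrite (prod_sorted4 ab bc cd) /g.
    by rewrite !inE !eqxx !orbT ba bcF da dc -GHGH.
  move=> x; rewrite !inE !negb_or => /and4P[xa xb xc xd].
  by rewrite (negbTE xa) (negbTE xb) (negbTE xc) (negbTE xd).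
have key : \sum_(i : {ffun 'I_k -> 'I_n}) (\prod_x w x (i x)) * xi i = 0.
  set s := \sum_i _.
  have : s%:A = - (s%:A) :> B.
    transitivity (\sum_(i : {ffun 'I_k -> 'I_n}) (\prod_x w x (i x)) *:
        \sum_j xi j *: \prod_x flip_mx sigma p (i x) (j x)).
      by rewrite scaler_suml; apply: eq_bigr => i _; rewrite fx scalerA.
    transitivity (\sum_(j : {ffun 'I_k -> 'I_n}) xi j *:
        \prod_x \sum_y w x y *: flip_mx sigma p y (j x)).
      under eq_bigr => i _ do rewrite scaler_sumr.
      rewrite exchange_big; apply: eq_bigr => j _ /=.
      rewrite bigA_distr_bigA /= scaler_sumr; apply: eq_bigr => i _.
      by rewrite scaler_prod scalerA mulrC -scalerA.
    rewrite scaler_suml -sumrN; apply: eq_bigr => j _.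
    under eq_bigr => x _ do rewrite wv.
    by rewrite scaler_prod prod_g scalerA scalerN mulrC.
  move/eqP; rewrite -subr_eq0 opprK -mulr2n -scaler_nat scalerA.
  rewrite scaler_eq0 oner_eq0 orbF mulf_eq0 pnatr_eq0 /=.
  by move/eqP.
(* A word of nonzero weight takes at each [x] the letter [j0 x] or its flip, so its kernel refines
   that of [j0], the letters [b2] and [c2] being fresh. Strictly finer kernels contribute 0 by [IH].
   The others have weight 1, since the signs at [a] and [c] agree, as do those at [b] and [d]. Hence
   [key] is a multiple of [xi j0] by a positive integer. *)
pose K := [pred j : {ffun 'I_k -> 'I_n} | [forall x, forall y, (j x == j y) == (j0 x == j0 y)]
   && (\prod_x w x (j x) != 0)].
have KE : \sum_(j in K) xi j0 = 0.
  rewrite -[RHS]key big_mkcond /=; apply: eq_bigr => j _.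
  rewrite !inE.
  have [w0|w0] := eqVneq (\prod_x w x (j x)) 0.
    by rewrite andbF w0 mul0r.
  rewrite andbT; have sj x y : sigma (j0 y) = j0 x -> j0 x = j0 y.
    rewrite cross_flipE (negbTE (fb y)) (negbTE (fc y)).
    case: eqP => [_ e|_]; first by move: (fb x); rewrite -e eqxx.
    by case: eqP => [_ e|_ ->] //; move: (fc x); rewrite -e eqxx.
  have hw x : (j x == j0 x) || (j x == sigma (j0 x)).
    move/prodf_neq0: w0 => /(_ x isT); rewrite /w.
    by case: (j x == j0 x) => //; case: (j x == sigma _) => //; rewrite eqxx.
  have coarse x y : j x = j y -> j0 x = j0 y.
    case/orP: (hw x) => /eqP ->; case/orP: (hw y) => /eqP -> //.
    - by move/esym/sj.
    - by move/sj.
    - by move/(can_inj cross_flipK).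
  have [/'forall_forallP kerb|] :=
    boolP [forall x, forall y, (j x == j y) == (j0 x == j0 y)]; last first.
    move=> /forallPn[x /forallPn[y nxy]]; rewrite IH ?mulr0 //.
    exists x, y; move: nxy; case: (eqVneq (j x) (j y)) => [/coarse ->|/eqP jxy].
      by rewrite eqxx.
    by case: (eqVneq (j0 x) (j0 y)).
  have ker x y : (j x == j y) = (j0 x == j0 y) by rewrite (eqP (kerb x y)).
  have xiE : xi j = xi j0 by apply: tperm_inv_kernel.
  have sq x y : x \in S -> y \in S -> j0 x = j0 y -> w x (j x) * w y (j y) = 1.
    move=> xS yS xy; have jxy : j x = j y by apply/eqP; rewrite ker xy.
    rewrite /w xS yS xy jxy; case: eqP => yN; first by rewrite mulr1.
    case: eqP => yE; first by rewrite mulrNN mulr1.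
    by have := hw y => /orP[] /eqP.
  rewrite xiE (bigD1 a) // (bigD1 c) ?ca // (bigD1 b) ?ba ?bcF //
    (bigD1 d) ?da ?dc ?db // big1; last first.
    move=> x /andP[/andP[/andP[xa xc] xb] xd].
    rewrite /w !inE (negbTE xa) (negbTE xb) (negbTE xc) (negbTE xd) /=.
    by have := hw x => /orP[] /eqP ->; rewrite ?eqxx //; case: ifP.
  rewrite /= mulr1 mulrA !sq ?mulr1 ?mul1r ?inE ?eqxx ?orbT //.
move: KE; rewrite sumr_const => /eqP; rewrite mulrn_eq0 => /orP[|/eqP//].
rewrite -leqn0 leqNgt => /negP[]; apply/card_gt0P; exists j0.
rewrite !inE; apply/andP; split.
  by apply/forallP => x; apply/forallP => y.
by rewrite big1 ?oner_eq0 // => x _; rewrite /w eqxx.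
Qed.
End Crossing.
End FixedVectors.

Section FixedSpan.
Variables (F : numFieldType) (B : algType F) (k n : nat).
Implicit Types xi : {ffun 'I_k -> 'I_n} -> F.
Variables (P Q : B).
Hypotheses (PP : P * P = P) (QQ : Q * Q = Q).
Hypothesis GHGH : (P *+ 2 - 1) * ((Q *+ 2 - 1) * ((P *+ 2 - 1) * (Q *+ 2 - 1))) = -1.
Hypothesis kn : (k + 2 <= n)%N.

(** Exactly the tests to which universality will be applied: [0] for the transpositions, [P] and [Q]
    for the crossings. *)
Definition flip_fixed xi := forall (sigma : 'I_n -> 'I_n) (p : 'I_n -> B),
  involutive sigma -> (forall i, p (sigma i) = p i) ->
  (forall i, p i \in [:: 0; P; Q]) -> fixed_vec (flip_mx sigma p) xi.

Lemma flip_fixed_tperm_inv xi : flip_fixed xi -> tperm_inv xi.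
Proof.
move=> fx a b; apply: fixed_vec_tperm (fx (tperm a b) (fun=> 0 : B) _ _ _) => //.
  by move=> y; rewrite tpermK.
by move=> _; rewrite inE eqxx.
Qed.

Lemma fresh_pair (j : {ffun 'I_k -> 'I_n}) : exists b2 c2,
  [/\ forall x, j x != b2, forall x, j x != c2 & b2 != c2].
Proof.
have /card_gt1P[b2 [c2 []]] : (1 < #|~: [set j x | x : 'I_k]|)%N.
  rewrite cardsCs finset.setCK card_ord ltn_subRL addn1.
  apply: leq_trans kn; rewrite addn2 !ltnS.
  by rewrite -[X in (_ <= X)%N]card_ord; apply: leq_imset_card.
rewrite !inE => bj cj bc; exists b2, c2; split=> // x.
  by apply: contraNneq bj => <-; apply: imset_f.
by apply: contraNneq cj => <-; apply: imset_f.
Qed.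

(** Induction on the kernel: at a crossing kernel [crossing_vanish] asks for vanishing at all
    strictly finer kernels, and noncrossing kernels are covered by assumption. *)
Lemma flip_fixed_eq0 xi : flip_fixed xi ->
  (forall j, noncrossing (ker_part j) -> xi j = 0) -> forall j, xi j = 0.
Proof.
move=> fx xi0 j.
have [m] := ubnP (kernel_pairs (ker_part j)); elim: m j => // m IH j jm.
have [/xi0//|/negP cr] := boolP (noncrossing (ker_part j)).
have : ~ forall a b c d : 'I_k, (a < b)%N -> (b < c)%N -> (c < d)%N ->
    j a = j c -> j b = j d -> j a = j b.
  move=> h; apply/cr/(noncrossingP (ker_partP j)) => a b c d ab bc cd.
  move=> /eqP; rewrite pblock_ker => /eqP ac /eqP; rewrite pblock_ker => /eqP bd.
  by apply/eqP; rewrite pblock_ker; apply/eqP/(h a b c d).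
move=> /existsNP[a /existsNP[b /existsNP[c /existsNP[d]]]].
move=> /not_implyP[ab /not_implyP[bc /not_implyP[cd /not_implyP[ac /not_implyP[bd]]]]].
move=> /eqP nab.
have [b2 [c2 [fb fc bc2]]] := fresh_pair j.
apply: (crossing_vanish GHGH ab bc cd ac bd nab fb fc bc2) => //.
- apply: fx.
  + exact: cross_flipK.
  + exact: cross_proj_flip.
  + by move=> i; rewrite /cross_proj; case: ifP => _; rewrite !inE eqxx ?orbT.
- exact: flip_fixed_tperm_inv.
- move=> j' fine [x [y [xy /eqP nxy]]]; apply: IH; rewrite ltnS in jm.
  apply: leq_trans jm; apply: kernel_pairs_lt; rewrite ?ker_partP //.
    apply/finerP => z t /eqP; rewrite pblock_ker => /eqP/fine zt.
    by apply/eqP; rewrite pblock_ker zt.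
  apply: contraNneq nxy => e; rewrite -pblock_ker e pblock_ker.
  exact/eqP.
Qed.

Lemma flip_fixed_constant_on p : p \in NC k ->
  flip_fixed (fun j => (constant_on p j)%:R).
Proof.
move=> pNC sigma q sK qs qP i.
have n0 : (0 < n)%N by apply: leq_trans kn; rewrite addn2.
have qq l : q l * q l = q l.
  by have := qP l; rewrite !inE => /or3P[] /eqP ->; rewrite ?mulr0.
have := @sum_noncrossing_magic k n p (NC_partition pNC) F B _ i n0
  (flip_row_magic sK qq qs) (NC_noncrossing pNC).
rewrite scaler_nat => <-; rewrite [RHS]big_mkcond.
by apply: eq_bigr => j _; rewrite scaler_nat; case: (constant_on p j); rewrite ?mulr1n ?mulr0n.
Qed.

(* Subtract the combination of noncrossing vectors that agrees with [xi] on
   the words with noncrossing kernel. *)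
Lemma flip_fixed_span xi : flip_fixed xi ->
  exists c : 'I_#|NC k| -> F, forall j,
    xi j = \sum_p c p * (constant_on (enum_val p) j)%:R.
Proof.
move=> fx; have kn' : (k <= n)%N by apply: leq_trans kn; rewrite leq_addr.
(* On a word with kernel [q], the indicator of constancy on [p] is [finer p q]. Interpolating [xi]
   on one representative word per noncrossing kernel therefore amounts to inverting the zeta
   matrix. *)
pose v : 'rV[F]_#|NC k| := \row_q xi (rep_fun kn' (enum_val q)).
pose c := v *m invmx (zeta_mx k F).
have cE : c *m zeta_mx k F = v by rewrite mulmxKV // zeta_mx_unit.
exists (fun p => c 0 p) => j.
apply/eqP; rewrite -subr_eq0; apply/eqP; move: j.
apply: flip_fixed_eq0.
- move=> sigma q sK qs qP i.
  rewrite scalerBl -(fx _ _ sK qs qP) scaler_suml.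
  under [X in _ = _ - X]eq_bigr => p _.
    rewrite -scalerA -(flip_fixed_constant_on (enum_valP p) sK qs qP). over.
  under [LHS]eq_bigr => j _ do rewrite scalerBl.
  rewrite sumrB; congr (_ - _).
  under [LHS]eq_bigr => j _ do rewrite scaler_suml.
  rewrite exchange_big; apply: eq_bigr => p _ /=.
  by rewrite scaler_sumr; apply: eq_bigr => j _; rewrite scalerA.
- move=> j nc.
  have jNC : ker_part j \in NC k by rewrite inE ker_partP nc.
  pose r := rep_fun kn' (ker_part j).
  have rj x y : (j x == j y) = (r x == r y).
    by rewrite rep_fun_eq ?ker_partP // pblock_ker.
  rewrite (tperm_inv_kernel (flip_fixed_tperm_inv fx) rj).
  have := congr1 (fun M : 'rV_ _ => M 0 (enum_rank_in jNC (ker_part j))) cE.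
  rewrite !mxE enum_rankK_in // => <-; apply/eqP; rewrite subr_eq0; apply/eqP.
  by apply: eq_bigr => p _; rewrite [X in _ * X]mxE enum_rankK_in // constant_on_ker.
Qed.
End FixedSpan.

(** * The C*-algebra of complex matrices *)

Section VectorNorm.
Variables (R : realType) (n : nat).
Local Notation C := R[i].
Implicit Types (v w : 'cV[C]_n) (A : 'M[C]_n) (c : C).

Definition adj m1 m2 (A : 'M[C]_(m1, m2)) : 'M[C]_(m2, m1) := (map_mx (@conjc R) A)^T.

Lemma adjK m1 m2 (A : 'M[C]_(m1, m2)) : adj (adj A) = A.
Proof. by apply/matrixP => i j; rewrite !mxE conjcK. Qed.

Lemma adjM m1 m2 m3 (A : 'M[C]_(m1, m2)) (B : 'M[C]_(m2, m3)) :
  adj (A *m B) = adj B *m adj A.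
Proof. by rewrite /adj map_mxM trmx_mul. Qed.

Lemma adjD m1 m2 (A B : 'M[C]_(m1, m2)) : adj (A + B) = adj A + adj B.
Proof. by rewrite /adj map_mxD linearD. Qed.

Lemma adjZ m1 m2 c (A : 'M[C]_(m1, m2)) : adj (c *: A) = conjc c *: adj A.
Proof. by rewrite /adj map_mxZ linearZ. Qed.

(** The real part of the Hermitian product already induces the norm and makes [adj] the adjoint, so
    Cauchy-Schwarz can be proved for a real inner product. *)
Definition rdot v w : R := complex.Re ((adj v *m w) 0 0).

Lemma rdot_adj A v w : rdot (A *m v) w = rdot v (adj A *m w).
Proof. by rewrite /rdot adjM mulmxA. Qed.

Lemma rdotC v w : rdot v w = rdot w v.
Proof.
rewrite /rdot -[in RHS](adjK v) -adjM !mxE.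
by case: (\sum_j _).
Qed.

Lemma rdotDl u v w : rdot (u + v) w = rdot u w + rdot v w.
Proof. by rewrite /rdot adjD mulmxDl mxE raddfD. Qed.

Lemma rdotZl (a : R) v w : rdot (a%:C *: v) w = a * rdot v w.
Proof.
rewrite /rdot adjZ conjc_real -scalemxAl mxE.
by case: (_ 0 0) => x y /=; rewrite mul0r subr0.
Qed.

Lemma rdotDr u v w : rdot w (u + v) = rdot w u + rdot w v.
Proof. by rewrite ![rdot w _]rdotC rdotDl. Qed.

Lemma rdotZr (a : R) v w : rdot w (a%:C *: v) = a * rdot w v.
Proof. by rewrite ![rdot w _]rdotC rdotZl. Qed.

Definition sqnorm v : R := rdot v v.

Definition cabs c : R := complex.Re `|c|.

Lemma cabsE c : (cabs c)%:C = `|c|.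
Proof. by rewrite /cabs RRe_real // normr_real. Qed.

Lemma cabs_ge0 c : 0 <= cabs c.
Proof. by rewrite -ler0c cabsE. Qed.

Lemma cabs_sqr c : (cabs c ^+ 2)%:C = conjc c * c.
Proof. by rewrite rmorphXn /= cabsE sqr_normc mulrC. Qed.

Lemma sqnormE v : sqnorm v = \sum_i cabs (v i 0) ^+ 2.
Proof.
have ReD : {morph @complex.Re R : x y / x + y} by case=> a b [].
rewrite /sqnorm /rdot mxE (big_morph _ ReD (erefl _)).
by apply: eq_bigr => i _; rewrite !mxE -cabs_sqr.
Qed.

Lemma sqnorm_ge0 v : 0 <= sqnorm v.
Proof. by rewrite sqnormE; apply: sumr_ge0 => i _; rewrite sqr_ge0. Qed.

Lemma sqnorm_eq0 v : sqnorm v = 0 -> v = 0.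
Proof.
rewrite sqnormE => /eqP; rewrite psumr_eq0; last by move=> i _; rewrite sqr_ge0.
move=> /allP h; apply/colP => i; rewrite mxE.
have := h i; rewrite mem_index_enum => /(_ isT) /=; rewrite sqrf_eq0 => /eqP ci.
by apply/eqP; rewrite -normr_eq0 -cabsE ci.
Qed.

Lemma rdot_CauchySchwarz v w : rdot v w ^+ 2 <= sqnorm v * sqnorm w.
Proof.
have [/sqnorm_eq0 -> | w0] := eqVneq (sqnorm w) 0.
  by rewrite /sqnorm /rdot !mulmx0 !mxE /= expr0n mulr0.
have W : 0 < sqnorm w by rewrite lt_def w0 sqnorm_ge0.
(* Up to the factor [sqnorm w], this vector is the component of [v] orthogonal to [w]. *)
have := sqnorm_ge0 ((sqnorm w)%:C *: v + (- rdot v w)%:C *: w).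
rewrite /sqnorm rdotDl !rdotDr !rdotZl !rdotZr [rdot w v]rdotC -/(sqnorm w) -/(sqnorm v).
rewrite [X in 0 <= X](_ : _ = sqnorm w * (sqnorm v * sqnorm w - rdot v w ^+ 2)).
  by rewrite pmulr_rge0 // subr_ge0.
by rewrite /sqnorm; ring.
Qed.

Definition vnorm v : R := Num.sqrt (sqnorm v).

Lemma vnorm_ge0 v : 0 <= vnorm v. Proof. exact: sqrtr_ge0. Qed.

Lemma vnorm_sqr v : vnorm v ^+ 2 = sqnorm v.
Proof. by rewrite sqr_sqrtr // sqnorm_ge0. Qed.

Lemma vnorm_eq0 v : vnorm v = 0 -> v = 0.
Proof. by move=> v0; apply: sqnorm_eq0; rewrite -vnorm_sqr v0 expr0n. Qed.

Lemma rdot_le v w : rdot v w <= vnorm v * vnorm w.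
Proof.
apply: le_trans (ler_norm _) _.
rewrite -(@ler_pXn2r _ 2) ?nnegrE ?mulr_ge0 ?vnorm_ge0 //.
by rewrite real_normK ?num_real // exprMn !vnorm_sqr rdot_CauchySchwarz.
Qed.

Lemma vnormD v w : vnorm (v + w) <= vnorm v + vnorm w.
Proof.
rewrite -(@ler_pXn2r _ 2) ?nnegrE ?addr_ge0 ?vnorm_ge0 //.
rewrite vnorm_sqr /sqnorm rdotDl !rdotDr [rdot w v]rdotC -!/(sqnorm _) -!vnorm_sqr.
by have := rdot_le v w; nra.
Qed.

Lemma vnormZ c v : vnorm (c *: v) = cabs c * vnorm v.
Proof.
rewrite /vnorm !sqnormE.
under eq_bigr => i _.
  rewrite mxE (_ : cabs (c * v i 0) = cabs c * cabs (v i 0)); last first.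
    by apply: complexI; rewrite rmorphM /= !cabsE normrM.
  rewrite exprMn. over.
by rewrite -mulr_sumr sqrtrM ?sqr_ge0 // sqrtr_sqr ger0_norm ?cabs_ge0.
Qed.

Lemma vnorm0 : vnorm 0 = 0.
Proof. by rewrite -[0](scale0r (0 : 'cV_n)) vnormZ /cabs normr0 mul0r. Qed.

Lemma vnorm_sum (I : finType) (f : I -> 'cV[C]_n) :
  vnorm (\sum_i f i) <= \sum_i vnorm (f i).
Proof.
apply: (big_ind2 (fun x y => vnorm x <= y)) => // [|x1 x2 y1 y2 h1 h2].
  by rewrite vnorm0.
by apply: le_trans (vnormD _ _) _; apply: lerD.
Qed.

Lemma cabs_le_vnorm v i : cabs (v i 0) <= vnorm v.
Proof.
rewrite -(@ler_pXn2r _ 2) ?nnegrE ?cabs_ge0 ?vnorm_ge0 //.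
rewrite vnorm_sqr sqnormE (bigD1 i) //= lerDl.
by apply: sumr_ge0 => j _; rewrite sqr_ge0.
Qed.
End VectorNorm.

Lemma real_cauchy_limit (R : realType) (x : nat -> R) :
  (forall e : R, 0 < e -> exists N : nat, forall m l : nat,
     (N <= m)%N -> (N <= l)%N -> `|x m - x l| < e) ->
  exists l, forall e : R, 0 < e -> exists N : nat, forall m : nat,
     (N <= m)%N -> `|x m - l| < e.
Proof.
move=> h; have : cvg (x @ \oo)%classic.
  apply: cauchy_cvg; apply: cauchy_exP => e e0.
  have [N hN] := h e e0; exists (x N), N => // m /= Nm.
  by rewrite /ball /=; apply: hN.
move=> /cvg_ex[l /cvgrPdist_lt xl]; exists l => e /xl[N _ hN].
by exists N => m Nm; rewrite distrC; apply: hN.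
Qed.

Section ComplexModulus.
Variable R : realType.
Implicit Type z : R[i].

Lemma cabs_sqrE z : cabs z ^+ 2 = complex.Re z ^+ 2 + complex.Im z ^+ 2.
Proof. by apply: complexI; rewrite add_Re2_Im2 rmorphXn /= cabsE. Qed.

Lemma cabs_ge_Re z : `|complex.Re z| <= cabs z.
Proof.
rewrite -(@ler_pXn2r _ 2) ?nnegrE ?cabs_ge0 // cabs_sqrE.
by rewrite real_normK ?num_real // lerDl sqr_ge0.
Qed.

Lemma cabs_ge_Im z : `|complex.Im z| <= cabs z.
Proof.
rewrite -(@ler_pXn2r _ 2) ?nnegrE ?cabs_ge0 // cabs_sqrE.
by rewrite real_normK ?num_real // lerDr sqr_ge0.
Qed.

Lemma cabs_le_ReIm z : cabs z <= `|complex.Re z| + `|complex.Im z|.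
Proof.
rewrite -(@ler_pXn2r _ 2) ?nnegrE ?cabs_ge0 ?addr_ge0 // cabs_sqrE.
rewrite sqrrD !real_normK ?num_real // -addrA lerD2l lerDr.
by rewrite mulrn_wge0 // mulr_ge0.
Qed.
End ComplexModulus.

Section OperatorNorm.
Variables (R : realType) (n : nat).
Local Notation C := R[i].
Local Notation M := 'M[C]_n.
Implicit Types (v w : 'cV[C]_n) (A B : M) (c : C).

(** Requiring [0 <= m] bounds the set below also for [n = 0], where the inequality on vectors is
    void. *)
Definition opbounds A : set R :=
  [set m | 0 <= m /\ forall v, vnorm (A *m v) <= m * vnorm v]%classic.

Definition opnorm A : R := inf (opbounds A).

Lemma vnorm_delta (i : 'I_n) : vnorm (delta_mx i 0 : 'cV[C]_n) = 1.
Proof.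
rewrite /vnorm sqnormE (bigD1 i) //= big1 ?addr0; last first.
  by move=> l /negbTE li; rewrite mxE li /cabs normr0 expr0n.
by rewrite mxE !eqxx /cabs normr1 expr1n sqrtr1.
Qed.

Lemma delta_vnorm (i j : 'I_n) v : vnorm (delta_mx i j *m v) <= vnorm v.
Proof.
rewrite (_ : delta_mx i j *m v = v j 0 *: delta_mx i 0); last first.
  apply/colP => l; rewrite !mxE (bigD1 j) //= big1 ?addr0; last first.
    by move=> m /negbTE mj; rewrite mxE mj andbF mul0r.
  by rewrite mxE !eqxx !andbT mulrC.
by rewrite vnormZ vnorm_delta mulr1 cabs_le_vnorm.
Qed.

Lemma opbounds_sum A : opbounds A (\sum_i \sum_j cabs (A i j)).
Proof.
split=> [|v].
  by apply: sumr_ge0 => i _; apply: sumr_ge0 => j _; apply: cabs_ge0.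
rewrite {1}[A]matrix_sum_delta mulmx_suml mulr_suml.
apply: le_trans (vnorm_sum _) _; apply: ler_sum => i _.
rewrite mulmx_suml mulr_suml.
apply: le_trans (vnorm_sum _) _; apply: ler_sum => j _.
by rewrite -scalemxAl vnormZ ler_wpM2l ?cabs_ge0 ?delta_vnorm.
Qed.

Lemma opbounds_inf A : has_inf (opbounds A).
Proof.
split; first by eexists; apply: opbounds_sum.
by exists 0 => m [].
Qed.

Lemma opnorm_ge0 A : 0 <= opnorm A.
Proof. by apply: lb_le_inf; [case: (opbounds_inf A)|move=> m []]. Qed.

Lemma opnorm_le A m : 0 <= m -> (forall v, vnorm (A *m v) <= m * vnorm v) ->
  opnorm A <= m.
Proof. by move=> m0 h; apply: ge_inf => //; case: (opbounds_inf A). Qed.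

Lemma opnormP A v : vnorm (A *m v) <= opnorm A * vnorm v.
Proof.
have [/vnorm_eq0 ->|v0] := eqVneq (vnorm v) 0.
  by rewrite mulmx0 vnorm0 mulr0.
have vp : 0 < vnorm v by rewrite lt_def v0 vnorm_ge0.
rewrite -ler_pdivrMr //; apply: lb_le_inf; first by case: (opbounds_inf A).
by move=> m [m0 h]; rewrite ler_pdivrMr.
Qed.

Lemma cabs_le_opnorm A i j : cabs (A i j) <= opnorm A.
Proof.
have -> : A i j = (A *m delta_mx j (0 : 'I_1)) i 0 by rewrite -colE mxE.
apply: le_trans (cabs_le_vnorm _ _) _; apply: le_trans (opnormP _ _) _.
by rewrite vnorm_delta mulr1.
Qed.

Lemma opnorm_le_sum A : opnorm A <= \sum_i \sum_j cabs (A i j).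
Proof. by case: (opbounds_sum A) => h0 h; apply: opnorm_le. Qed.

Lemma opnorm_eq0 A : opnorm A = 0 -> A = 0.
Proof.
move=> A0; apply/matrixP => i j; rewrite mxE.
apply/eqP; rewrite -normr_eq0 -cabsE; apply/eqP; congr (_%:C).
by apply/eqP; rewrite eq_le cabs_ge0 andbT -A0 cabs_le_opnorm.
Qed.

Lemma opnormD A B : opnorm (A + B) <= opnorm A + opnorm B.
Proof.
apply: opnorm_le => [|v]; first by rewrite addr_ge0 ?opnorm_ge0.
by rewrite mulmxDl mulrDl (le_trans (vnormD _ _)) // lerD ?opnormP.
Qed.

Lemma opnormM A B : opnorm (A *m B) <= opnorm A * opnorm B.
Proof.
apply: opnorm_le => [|v]; first by rewrite mulr_ge0 ?opnorm_ge0.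
rewrite -mulmxA -mulrA (le_trans (opnormP _ _)) // ler_wpM2l ?opnorm_ge0 //.
exact: opnormP.
Qed.

Lemma opnormZ c A : opnorm (c *: A) = cabs c * opnorm A.
Proof.
have le d D : opnorm (d *: D) <= cabs d * opnorm D.
  apply: opnorm_le => [|v]; first by rewrite mulr_ge0 ?cabs_ge0 ?opnorm_ge0.
  by rewrite -scalemxAl vnormZ -mulrA ler_wpM2l ?cabs_ge0 ?opnormP.
apply/eqP; rewrite eq_le le /=.
have [->|c0] := eqVneq c 0; first by rewrite /cabs normr0 mul0r opnorm_ge0.
have cp : 0 < cabs c.
  by rewrite lt_def cabs_ge0 andbT; apply: contraNneq c0 => e; rewrite -normr_eq0 -cabsE e.
have e : c^-1 *: (c *: A) = A by rewrite scalerA (mulVf c0) scale1r.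
have cV : cabs c^-1 = (cabs c)^-1.
  by apply: complexI; rewrite fmorphV /= !cabsE normfV.
have := le c^-1 (c *: A); rewrite e cV => leA.
by rewrite -(ler_pM2l (x := (cabs c)^-1)) ?invr_gt0 // mulKf // gt_eqF.
Qed.

(** The square of the norm of [D *m v] is the product of [v] with [adj D *m D *m v], which gives
    [sq]. Submultiplicativity then yields that the norm of [D] is at most that of [adj D], hence the
    other inequality. *)
Lemma opnorm_adj A : opnorm (adj A *m A) = opnorm A ^+ 2.
Proof.
have sq D : opnorm D ^+ 2 <= opnorm (adj D *m D).
  rewrite -[leRHS]sqr_sqrtr ?opnorm_ge0 // ler_pXn2r ?nnegrE ?opnorm_ge0 ?sqrtr_ge0 //.
  apply: opnorm_le => [|v]; first exact: sqrtr_ge0.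
  rewrite -(@ler_pXn2r _ 2) ?nnegrE ?mulr_ge0 ?sqrtr_ge0 ?vnorm_ge0 //.
  rewrite exprMn (sqr_sqrtr (opnorm_ge0 _)) (vnorm_sqr (D *m v)) /sqnorm rdot_adj.
  apply: le_trans (rdot_le _ _) _.
  by rewrite mulmxA expr2 mulrA mulrC ler_wpM2r ?vnorm_ge0 ?opnormP.
have le D : opnorm D <= opnorm (adj D).
  have [->|D0] := eqVneq (opnorm D) 0; first exact: opnorm_ge0.
  have Dp : 0 < opnorm D by rewrite lt_def D0 opnorm_ge0.
  by have := le_trans (sq D) (opnormM (adj D) D); rewrite expr2 ler_pM2r.
have lA : opnorm (adj A) <= opnorm A by have := le (adj A); rewrite adjK.
apply/eqP; rewrite eq_le sq andbT expr2.
apply: le_trans (opnormM (adj A) A) _.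
exact: ler_wpM2r (opnorm_ge0 A) _ _ lA.
Qed.

Lemma opnorm_complete (x : nat -> M) :
  (forall e : R, 0 < e -> exists N : nat, forall m l : nat,
     (N <= m)%N -> (N <= l)%N -> opnorm (x m - x l) < e) ->
  exists l : M, forall e : R, 0 < e -> exists N : nat, forall m : nat,
     (N <= m)%N -> opnorm (x m - l) < e.
Proof.
move=> cauchy.
have lim_part (f : C -> R) i j : {morph f : y z / y - z} ->
    (forall z, `|f z| <= cabs z) ->
    exists l, forall e : R, 0 < e -> exists N : nat, forall m : nat,
     (N <= m)%N -> `|f (x m i j) - l| < e.
  move=> fB fl; apply: real_cauchy_limit => e e0.
  have [N hN] := cauchy e e0; exists N => m l Nm Nl.
  rewrite -fB; apply: le_lt_trans (fl _) _.
  by apply: le_lt_trans (hN _ _ Nm Nl); have := cabs_le_opnorm (x m - x l) i j; rewrite !mxE.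
have ReB : {morph @complex.Re R : y z / y - z} by case=> a b [].
have ImB : {morph @complex.Im R : y z / y - z} by case=> a b [].
have [re hre] := choice (fun z : 'I_n * 'I_n => lim_part _ z.1 z.2 ReB (@cabs_ge_Re R)).
have [im him] := choice (fun z : 'I_n * 'I_n => lim_part _ z.1 z.2 ImB (@cabs_ge_Im R)).
exists (\matrix_(i, j) Complex (re (i, j)) (im (i, j))) => e e0.
(* Each of the [n * n] entries costs at most [2 * d], one [d] for each of its real and imaginary
   parts. The successor makes the final bound strict and the denominator nonzero. *)
pose d := e / (n * n * 2).+1%:R.
have d0 : 0 < d by rewrite divr_gt0.
have [N1 h1] := choice (fun z => hre z _ d0).
have [N2 h2] := choice (fun z => him z _ d0).
exists (\max_z maxn (N1 z) (N2 z)) => m Nm.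
apply: le_lt_trans (opnorm_le_sum _) _.
apply: (@le_lt_trans _ _ (\sum_(i < n) \sum_(j < n) d *+ 2)).
  apply: ler_sum => i _; apply: ler_sum => j _; rewrite !mxE.
  have := leq_trans (leq_bigmax (i, j)) Nm; rewrite geq_max => /andP[m1 m2].
  apply: le_trans (cabs_le_ReIm _) _; rewrite mulr2n lerD // ?ReB ?ImB /=.
    exact/ltW/(h1 (i, j)).
  exact/ltW/(h2 (i, j)).
rewrite !sumr_const card_ord -!mulrnA /d -[X in X < _]mulr_natr mulrAC -mulrA.
rewrite gtr_pMr // ltr_pdivrMr // mul1r ltr_nat.
by rewrite ltnS mulnC.
Qed.
End OperatorNorm.

(** Universality in [is_As] ranges over C*-algebras, so matrices must be equipped as such before
    they can serve as targets. *)
HB.instance Definition _ (R : realType) n := isCStarAlgebra.Build R 'M[R[i]]_n.+1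
  (@opnorm_eq0 R n.+1) (@opnormD R n.+1)
  (fun c A => etrans (congr1 _ (opnormZ c A))
    (etrans (rmorphM _ _ _) (congr1 ( *%R^~ _) (cabsE c))))
  (@opnormM R n.+1) (@opnorm_complete R n.+1)
  (@adjK R n.+1 n.+1) (@adjD R n.+1 n.+1) (@adjZ R n.+1 n.+1) (@adjM R n.+1 n.+1 n.+1)
  (@opnorm_adj R n.+1).

(** * Haar integrals *)

Section RawMorphisms.
Variables (K : pzRingType) (U V : lmodType K).

Lemma raw_linear_sum (f : U -> V) (I : finType) (P : pred I) (F : I -> U) :
  linear f -> f (\sum_(i | P i) F i) = \sum_(i | P i) f (F i).
Proof.
by move=> lf; pose g : {linear U -> V} := HB.pack f (GRing.isLinear.Build _ _ _ _ f lf);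
  rewrite -[f]/(g : U -> V) raddf_sum.
Qed.

Lemma raw_linearZ (f : U -> V) (a : K) (x : U) : linear f -> f (a *: x) = a *: f x.
Proof.
by move=> lf; pose g : {linear U -> V} := HB.pack f (GRing.isLinear.Build _ _ _ _ f lf);
  rewrite -[f]/(g : U -> V) linearZ.
Qed.

Lemma raw_scalar_sum (f : U -> K) (I : finType) (P : pred I) (F : I -> U) :
  scalar f -> f (\sum_(i | P i) F i) = \sum_(i | P i) f (F i).
Proof.
by move=> lf; pose g : {scalar U} := HB.pack f (GRing.isLinear.Build _ _ _ _ f lf);
  rewrite -[f]/(g : U -> K) raddf_sum.
Qed.

Lemma raw_scalarZ (f : U -> K) (a : K) (x : U) : scalar f -> f (a *: x) = a * f x.
Proof.
by move=> lf; pose g : {scalar U} := HB.pack f (GRing.isLinear.Build _ _ _ _ f lf);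
  rewrite -[f]/(g : U -> K) linearZ.
Qed.
End RawMorphisms.

Section Star.
Variables (R : realType) (A : cstarType R).
Implicit Types x y : A.

Lemma star0 : star (0 : A) = 0.
Proof. by apply: (addIr (star 0)); rewrite -starD !add0r. Qed.

Lemma star1 : star (1 : A) = 1.
Proof. by rewrite -[star 1]mul1r -{1}[1]starK -starM mul1r starK. Qed.

Lemma starN x : star (- x) = - star x.
Proof. by apply/eqP; rewrite -addr_eq0 -starD addNr star0. Qed.

Lemma star_exp x k : star x = x -> star (x ^+ k) = x ^+ k.
Proof.
by move=> xx; elim: k => [|k IH]; rewrite ?expr0 ?star1 // {1}exprS starM IH xx -exprSr.
Qed.

Lemma projection0 : projection (0 : A).
Proof. by split; [exact: star0|rewrite mulr0]. Qed.
End Star.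

Section TwoProjections.
Variable R : realType.
Local Notation B := 'M[R[i]]_2.

(** [proj_e] and [proj_d] project onto lines at an angle of 45 degrees. The corresponding
    reflections compose to a quarter turn, whose square is -1. *)
Definition proj_e : B := \matrix_(i, j) ((i == 0) && (j == 0))%:R.
Definition proj_d : B := \matrix_(i, j) 2^-1.

Lemma proj_eE : proj_e * proj_e = proj_e.
Proof.
apply/matrixP => i j; rewrite !mxE !big_ord_recl big_ord0 !mxE /= !eqxx /=.
by case: (i == 0); rewrite /= ?andbF ?mul0r ?mul1r ?mulr0 ?addr0.
Qed.

Lemma two_neq0 : (2 : R[i]) != 0. Proof. by rewrite pnatr_eq0. Qed.

Lemma proj_dE : proj_d * proj_d = proj_d.
Proof.
apply/matrixP => i j; rewrite !mxE !big_ord_recl big_ord0 !mxE /=.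
by rewrite addr0 -mulr2n -[LHS]mulr_natr -mulrA mulVf ?mulr1 // two_neq0.
Qed.

Lemma proj_e_proj : projection (proj_e : B).
Proof.
split; last exact: proj_eE.
by apply/matrixP => i j; rewrite !mxE conjc_nat andbC.
Qed.

Lemma proj_d_proj : projection (proj_d : B).
Proof.
split; last exact: proj_dE.
apply/matrixP => i j; rewrite !mxE.
by rewrite conjc_inv conjc_nat.
Qed.

Lemma two_proj_symmetries : (proj_e *+ 2 - 1) * ((proj_d *+ 2 - 1) *
  ((proj_e *+ 2 - 1) * (proj_d *+ 2 - 1))) = -1.
Proof.
have half : 2^-1 + 2^-1 = 1 :> R[i].
  by rewrite -mulr2n -[LHS]mulr_natr mulVf // two_neq0.
have GH : (proj_e *+ 2 - 1) * (proj_d *+ 2 - 1) =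
    \matrix_(i, j) (if i == j then 0 else if i == 0 then 1 else -1) :> B.
  apply/matrixP => i j; rewrite !mxE !big_ord_recl big_ord0 !mxE /=.
  case: i => [[|[|//]] ?]; case: j => [[|[|//]] ?]; rewrite -!val_eqE /= half;
    ring.
rewrite mulrA GH; apply/matrixP => i j; rewrite !mxE !big_ord_recl big_ord0 !mxE /=.
by case: i => [[|[|//]] ?]; case: j => [[|[|//]] ?]; rewrite -!val_eqE /=; ring.
Qed.

Lemma flip_magic_unitary (A : cstarType R) n (sigma : 'I_n -> 'I_n) (p : 'I_n -> A) :
  involutive sigma -> (forall i, p (sigma i) = p i) -> (forall i, projection (p i)) ->
  magic_unitary (\matrix_(i, j) flip_mx sigma p i j).
Proof.
move=> sK ps pp; have idem i : p i * p i = p i by case: (pp i).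
have sym i j : flip_mx sigma p i j = flip_mx sigma p j i by apply: flip_mx_sym.
split.
- move=> i j; rewrite mxE; split; last exact: flip_mx_idem.
  have [pi _] := pp i.
  rewrite /flip_mx starD; congr (_ + _).
    by case: eqP; rewrite ?mulr0n ?mulr1n ?star0.
  by case: eqP; rewrite ?mulr0n ?mulr1n ?star0 // starD starN star1 pi.
- by move=> i j l jl; rewrite !mxE flip_mx_row_orth.
- by move=> i j l il; rewrite !mxE ![flip_mx _ _ _ j]sym flip_mx_row_orth.
- by move=> i; under eq_bigr => j _ do rewrite mxE; apply: flip_mx_row_sum.
- move=> j; under eq_bigr => i _ do rewrite mxE sym.
  exact: flip_mx_row_sum.
Qed.
End TwoProjections.

Section Haar.
Variables (R : realType) (A AA : cstarType R) (n : nat) (u : 'M[A]_n).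
Variables (tens : A -> A -> AA) (Delta : A -> AA) (h : A -> R[i]).
Hypotheses (Au : is_As u) (tensP : is_cstar_tensor tens)
  (DeltaP : is_comultiplication tens u Delta) (haar : is_haar_state tens Delta h).
Variable k : nat.
Implicit Types i j l : {ffun 'I_k -> 'I_n}.

Definition monomial i j : A := \prod_x u (i x) (j x).

Lemma magic_col_magic : row_magic (fun a b => u b a).
Proof.
case: Au => -[pr r c rs cs] _; split=> // a b d.
case: eqP => [<-|/eqP ab]; first by case: (pr d a).
exact: r.
Qed.

Lemma comult_monomial i j :
  Delta (monomial i j) = \sum_l tens (monomial i l) (monomial l j).
Proof.
case: DeltaP => -[Dl [D1 DM] _] Du; case: tensP => _ [t1 tM] _ _ _.
rewrite /monomial (big_morph Delta DM D1).
under eq_bigr => x _ do rewrite Du.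
rewrite bigA_distr_bigA /=; apply: eq_bigr => l _.
elim/big_rec3: _ => // x a b c _ ->.
by rewrite tM.
Qed.

(** Invariance of [h], applied to the comultiplication of a monomial: the column [j] of Haar
    integrals is fixed by u^(tensor k), as an identity in [A]. *)
Lemma haar_monomial i j :
  \sum_l h (monomial l j) *: monomial i l = (h (monomial i j))%:A.
Proof.
case: haar => _ _ [L [Ll _ Lt] LD].
rewrite -LD comult_monomial (raw_linear_sum _ _ Ll).
by apply: eq_bigr => l _; rewrite Lt.
Qed.

(** The homomorphism given by universality carries [haar_monomial] over to the flip matrix and
    leaves the scalars [h (monomial l j)] untouched. *)
Lemma haar_column_fixed j :
  flip_fixed (proj_e R) (proj_d R) (fun i => h (monomial i j)).
Proof.
move=> sigma p sK ps pP i.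
case: Au => _ univ.
have pp a : projection (p a).
  have := pP a; rewrite !inE => /or3P[] /eqP ->.
  - exact: projection0.
  - exact: proj_e_proj.
  - exact: proj_d_proj.
have [f [[[fl [f1 fM] _] fu] _]] := univ _ _ (flip_magic_unitary sK ps pp).
have fmon i' j' : f (monomial i' j') = \prod_x flip_mx sigma p (i' x) (j' x).
  by rewrite (big_morph f fM f1); apply: eq_bigr => x _; rewrite fu mxE.
have := congr1 f (haar_monomial i j).
rewrite (raw_linear_sum _ _ fl) (raw_linearZ _ _ fl) f1 => <-.
by apply: eq_bigr => l _; rewrite (raw_linearZ _ _ fl) fmon.
Qed.

Lemma haar_column_span j : (k + 2 <= n)%N ->
  exists c : 'I_#|NC k| -> R[i], forall i,
    h (monomial i j) = \sum_p c p * (constant_on (enum_val p) i)%:R.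
Proof.
move=> kn; apply: (@flip_fixed_span _ _ _ _ (proj_e R) (proj_d R)) => //.
- exact: proj_eE.
- exact: proj_dE.
- exact: two_proj_symmetries.
- exact: haar_column_fixed.
Qed.

(** The state is applied to the invariance of T_p. The sum runs over the first index of the
    monomial, so that invariance is used for the transpose of [u]. *)
Lemma haar_row_fixed p j : (0 < n)%N -> p \in NC k ->
  \sum_(i | constant_on p i) h (monomial i j) = (constant_on p j)%:R.
Proof.
move=> n0 pNC; case: haar => -[hl _ h1] _ _.
have := congr1 h (@sum_noncrossing_magic k n p (NC_partition pNC) _ A
  (fun a b => u b a) j n0 magic_col_magic (NC_noncrossing pNC)).
rewrite (raw_scalar_sum _ _ hl) => ->.
by rewrite -[_%:R in LHS]scaler_nat (raw_scalarZ _ _ hl) h1 mulr1.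
Qed.

End Haar.

Section Gram.
Variables (k : nat).

(** The entries are integers cast into [F], so that invertibility and inverses pass between the real
    and the complex Gram matrix. *)
Definition gram_mx (F : pzSemiRingType) m : 'M[F]_#|NC k| := \matrix_(p, q)
  (\sum_(i : {ffun 'I_k -> 'I_m} |
     constant_on (enum_val p) i && constant_on (enum_val q) i) 1)%N%:R.

Lemma gram_mxE (F : pzSemiRingType) m p q : gram_mx F m p q =
  \sum_(i : {ffun 'I_k -> 'I_m})
    (constant_on (enum_val p) i)%:R * (constant_on (enum_val q) i)%:R.
Proof.
rewrite mxE natr_sum big_mkcond; apply: eq_bigr => i _.
by do 2!case: constant_on; rewrite /= ?mulr1 ?mulr0 ?mul0r.
Qed.

Lemma map_gram_mx (F K : nzRingType) (f : {rmorphism F -> K}) m :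
  map_mx f (gram_mx F m) = gram_mx K m.
Proof. by apply/matrixP => p q; rewrite !mxE rmorph_nat. Qed.
End Gram.

Section Moments.
Variables (R : realType) (A AA : cstarType R) (n : nat) (u : 'M[A]_n).
Variables (tens : A -> A -> AA) (Delta : A -> AA) (h : A -> R[i]).
Hypotheses (Au : is_As u) (tensP : is_cstar_tensor tens)
  (DeltaP : is_comultiplication tens u Delta) (haar : is_haar_state tens Delta h).
Variables (k s : nat).
Hypothesis sn : (s <= n)%N.

Definition widen_word (j : {ffun 'I_k -> 'I_s}) : {ffun 'I_k -> 'I_n} :=
  [ffun x => widen_ord sn (j x)].

Lemma constant_on_widen p j : constant_on p (widen_word j) = constant_on p j.
Proof. by apply: eq_forallb => x; apply: eq_forallb => y; rewrite !ffunE. Qed.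

Lemma truncated_trace_exp :
  truncated_trace u s ^+ k =
  \sum_(j : {ffun 'I_k -> 'I_s}) monomial u (widen_word j) (widen_word j).
Proof.
rewrite /truncated_trace big_ord_narrow.
rewrite -[X in _ ^+ X]card_ord -prodr_const bigA_distr_bigA /=.
by apply: eq_bigr => j _; apply: eq_bigr => x _; rewrite ffunE.
Qed.

(** Only the columns at words in the first [s] letters occur. [X] pairs their coefficients with the
    T_r over [s] letters: its trace is the moment, and [haar_row_fixed] gives [GX]. *)
Lemma haar_moment_trace : (k + 2 <= n)%N -> gram_mx k R n \in unitmx ->
  h (truncated_trace u s ^+ k) =
  (\tr (invmx (gram_mx k R n) *m gram_mx k R s))%:C.
Proof.
move=> kn Gu; have n0 : (0 < n)%N by apply: leq_trans kn; rewrite addn2.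
have [c hc] := choice (fun j : {ffun 'I_k -> 'I_s} =>
  haar_column_span Au tensP DeltaP haar (widen_word j) kn).
pose T p (j : {ffun 'I_k -> 'I_s}) : R[i] :=
  (constant_on (enum_val (A := NC k) p) j)%:R.
pose X : 'M[R[i]]_#|NC k| := \matrix_(q, r) \sum_j c j q * T r j.
have GX : gram_mx k R[i] n *m X = gram_mx k R[i] s.
  apply/matrixP => p r; rewrite mxE.
  under eq_bigr => q _ do rewrite [X _ _]mxE mulr_sumr.
  rewrite exchange_big gram_mxE; apply: eq_bigr => j _ /=.
  under eq_bigr => q _ do rewrite mulrA.
  rewrite -mulr_suml; congr (_ * _).
  have := haar_row_fixed Au haar (widen_word j) n0 (enum_valP p).
  rewrite constant_on_widen => <-; rewrite [RHS]big_mkcond /=.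
  under eq_bigr => q _ do rewrite gram_mxE mulr_suml.
  rewrite exchange_big; apply: eq_bigr => i _ /=.
  rewrite hc; case: constant_on; last by apply: big1 => q _; rewrite !mul0r.
  by apply: eq_bigr => q _; rewrite mul1r mulrC.
have GuC : gram_mx k R[i] n \in unitmx.
  by rewrite -(map_gram_mx k (real_complex R)) map_unitmx.
have XE : X = map_mx (real_complex R) (invmx (gram_mx k R n) *m gram_mx k R s).
  by rewrite map_mxM map_invmx !map_gram_mx -GX mulKmx.
rewrite truncated_trace_exp; case: haar => -[hl _ _] _ _.
rewrite (raw_scalar_sum _ _ hl) -[RHS](trace_map_mx (real_complex R)) -XE.
rewrite /mxtrace.
under [RHS]eq_bigr => q _ do rewrite mxE.
rewrite exchange_big; apply: eq_bigr => j _ /=.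
by rewrite hc; apply: eq_bigr => q _; rewrite constant_on_widen.
Qed.
End Moments.

(** * Asymptotics of Gram matrices *)

Local Open Scope classical_set_scope.
Local Open Scope ring_scope.

Section MatrixLimits.
Variable R : realType.

Lemma cvg_sum_fin (I : finType) (f : I -> nat -> R) (l : I -> R) :
  (forall i, f i @ \oo --> l i) ->
  (fun n => \sum_i f i n) @ \oo --> \sum_i l i.
Proof. by move=> fl; apply: cvg_big => //; exact: add_continuous. Qed.

Lemma cvg_prod_fin (I : finType) (f : I -> nat -> R) (l : I -> R) :
  (forall i, f i @ \oo --> l i) ->
  (fun n => \prod_i f i n) @ \oo --> \prod_i l i.
Proof. by move=> fl; apply: cvg_big => //; exact: mul_continuous. Qed.

Lemma cvg_det N (M : nat -> 'M[R]_N) (W : 'M[R]_N) :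
  (forall i j, (fun n => M n i j) @ \oo --> W i j) ->
  (fun n => \det (M n)) @ \oo --> \det W.
Proof.
move=> MW; apply: cvg_sum_fin => s.
by apply: cvgM; [exact: cvg_cst|apply: cvg_prod_fin => i].
Qed.

Lemma cvg_adj N (M : nat -> 'M[R]_N) (W : 'M[R]_N) :
  (forall i j, (fun n => M n i j) @ \oo --> W i j) ->
  forall i j, (fun n => (\adj (M n)) i j) @ \oo --> (\adj W) i j.
Proof.
move=> MW i j; rewrite mxE /cofactor.
under eq_cvg do rewrite mxE /cofactor.
apply: cvgM; first exact: cvg_cst.
apply: cvg_det => a b; rewrite !mxE.
by under eq_cvg do rewrite !mxE; exact: MW.
Qed.

Lemma cvg_unitmx N (M : nat -> 'M[R]_N) (W : 'M[R]_N) : W \in unitmx ->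
  (forall i j, (fun n => M n i j) @ \oo --> W i j) ->
  \forall n \near \oo, M n \in unitmx.
Proof.
rewrite unitmxE unitfE => W0 /cvg_det /cvgr_neq0 /(_ W0).
by apply: filterS => n; rewrite unitmxE unitfE.
Qed.

(** The limit is the trace of W^-1 diag(d) W, that is, of diag(d). The cofactor formula makes the
    inverse a continuous function of the entries. *)
Lemma cvg_trace_ratio N (M Y : nat -> 'M[R]_N) (W : 'M[R]_N) (d : 'rV[R]_N) :
  W \in unitmx ->
  (forall i j, (fun n => M n i j) @ \oo --> W i j) ->
  (forall i j, (fun n => Y n i j) @ \oo --> d 0 i * W i j) ->
  (fun n => \tr (invmx (M n) *m Y n)) @ \oo --> \sum_i d 0 i.
Proof.
move=> Wu MW YW.
have -> : \sum_i d 0 i = \sum_i \sum_j (\det W)^-1 * (\adj W) i j * (d 0 j * W j i).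
  transitivity (\tr (diag_mx d *m W *m invmx W)).
    by rewrite mulmxK // mxtrace_diag.
  rewrite mxtrace_mulC /mxtrace; apply: eq_bigr => i _; rewrite mxE.
  apply: eq_bigr => j _; rewrite /invmx Wu mxE; congr (_ * _).
  by rewrite mul_diag_mx mxE.
apply: (@cvg_trans _ ((fun n => \sum_i \sum_j (\det (M n))^-1 * (\adj (M n)) i j * Y n j i) @ \oo)).
  apply: near_eq_cvg; near=> n.
  rewrite /mxtrace; apply: eq_bigr => i _; rewrite mxE; apply: eq_bigr => j _.
  have Mu : M n \in unitmx by near: n; apply: cvg_unitmx Wu MW.
  by rewrite /invmx Mu [in RHS]mxE.
apply: cvg_sum_fin => i; apply: cvg_sum_fin => j.
apply: cvgM; last exact: YW.
apply: cvgM; last exact: cvg_adj.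
apply: cvgV; first by move: Wu; rewrite unitmxE unitfE.
exact: cvg_det.
Unshelve. all: by end_near. Qed.
End MatrixLimits.

Section GramLimits.
Variables (R : realType) (k : nat).
Hypothesis k0 : (0 < k)%N.
Local Notation N := #|NC k|.
Implicit Types p q : 'I_N.
Local Notation part p := (enum_val (A := NC k) p).

(** The rows are divided by powers of [n] whatever [s] is: G_n and G_s then share one diagonal
    factor, which cancels in the product of G_n^-1 and G_s. *)
Definition scaled_gram (n s : nat) : 'M[R]_N :=
  \matrix_(p, q) (gram_mx k R s p q / n%:R ^+ #|part p|).

Definition ratio (s n : nat) : R := s%:R / n%:R.

Lemma gram_finer s p q : finer (part q) (part p) ->
  gram_mx k R s p q = s%:R ^+ #|part p|.
Proof.
move=> qp; rewrite mxE card_constant_on_finer ?natrX //.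
exact/NC_partition/enum_valP.
Qed.

Lemma gram_ge0 s p q : 0 <= gram_mx k R s p q.
Proof. by rewrite mxE ler0n. Qed.

Lemma gram_le s p q : gram_mx k R s p q <= s%:R ^+ #|part p|.
Proof.
rewrite mxE -natrX ler_nat -(card_constant_on s (NC_partition (enum_valP p))).
by rewrite big_mkcondr /= leq_sum // => i _; case: ifP.
Qed.

Lemma gram_not_finer s p q : ~~ finer (part q) (part p) ->
  gram_mx k R s p q * s%:R <= s%:R ^+ #|part p|.
Proof.
move=> qp; rewrite mxE -natrX -natrM ler_nat.
by apply: card_constant_on2 qp; exact/NC_partition/enum_valP.
Qed.

Lemma scaled_gram_finer n s p q : finer (part q) (part p) ->
  scaled_gram n s p q = ratio s n ^+ #|part p|.
Proof. by move=> qp; rewrite mxE gram_finer // -expr_div_n. Qed.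

Lemma scaled_gram_ge0 n s p q : 0 <= scaled_gram n s p q.
Proof. by rewrite mxE divr_ge0 ?gram_ge0 // exprn_ge0. Qed.

Lemma scaled_gram_le n s p q : scaled_gram n s p q <= ratio s n ^+ #|part p|.
Proof.
by rewrite mxE /ratio expr_div_n ler_wpM2r ?gram_le // invr_ge0 exprn_ge0.
Qed.

Lemma scaled_gram_not_finer n s p q : (0 < s)%N -> ~~ finer (part q) (part p) ->
  scaled_gram n s p q <= ratio s n ^+ #|part p| / s%:R.
Proof.
move=> s0 qp; rewrite ler_pdivlMr ?ltr0n // mxE mulrAC /ratio expr_div_n.
by rewrite ler_wpM2r ?gram_not_finer // invr_ge0 exprn_ge0.
Qed.

Lemma cvg_invn : (fun n => n%:R^-1 : R) @ \oo --> (0 : R).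
Proof.
have := @cvg_harmonic R => h.
by rewrite -(cvg_shiftn 1) /=; under eq_cvg do rewrite addn1.
Qed.

(* Only the ratio [s n / n] and the divergence of [s] enter, so the same
   statement with [s = id] gives the limit of the scaled Gram matrix. *)
Lemma cvg_scaled_gram (s : nat -> nat) (t : R) : t != 0 ->
  (fun n => ratio (s n) n) @ \oo --> t ->
  forall p q, (fun n => scaled_gram n (s n) p q) @ \oo -->
    t ^+ #|part p| * (zeta_mx k R)^T p q.
Proof.
move=> t0 st p q; rewrite !mxE.
have stX : (fun n => ratio (s n) n ^+ #|part p|) @ \oo --> t ^+ #|part p|.
  by apply: (@continuous_cvg _ _ _ _ _ _ (@GRing.exp R ^~ _)) st; exact: exprn_continuous.
have [qp|qp] := boolP (finer (part q) (part p)).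
  by rewrite mulr1; under eq_cvg do rewrite scaled_gram_finer //.
rewrite mulr0.
(* A nonzero limit of [s n / n] forces [s n] to infinity. *)
have s_inv : (fun n => (s n)%:R^-1 : R) @ \oo --> (0 : R).
  rewrite -(mul0r t^-1).
  apply: (@cvg_trans _ ((fun n => n%:R^-1 * (ratio (s n) n)^-1) @ \oo)).
    apply: near_eq_cvg; near=> n.
    have n0 : n%:R != 0 :> R.
      by rewrite pnatr_eq0 -lt0n; near: n; exists 1%N.
    by rewrite /ratio invf_div mulrA mulVf // mul1r.
  by apply: cvgM; [exact: cvg_invn|exact: cvgV].
apply: (@squeeze_cvgr _ _ _ _ (cst 0) (fun n => ratio (s n) n ^+ #|part p| / (s n)%:R)).
- near=> n; rewrite scaled_gram_ge0 scaled_gram_not_finer //.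
  have : ratio (s n) n != 0 by near: n; apply: cvgr_neq0 st t0.
  by rewrite /ratio mulf_eq0 negb_or pnatr_eq0 lt0n => /andP[].
- exact: cvg_cst.
- by rewrite -(mulr0 (t ^+ #|part p|)); apply: cvgM.
Unshelve. all: by end_near. Qed.

Lemma cvg_ratio_id : (fun n => ratio n n) @ \oo --> (1 : R).
Proof.
apply: cvg_near_cst; near=> n.
have n0 : n%:R != 0 :> R by rewrite pnatr_eq0 -lt0n; near: n; exists 1%N.
by rewrite /ratio divff.
Unshelve. all: by end_near. Qed.

Lemma cvg_scaled_gram_id p q :
  (fun n => scaled_gram n n p q) @ \oo --> (zeta_mx k R)^T p q.
Proof.
have := @cvg_scaled_gram id 1 (oner_neq0 R) cvg_ratio_id p q.
by rewrite expr1n mul1r.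
Qed.

Lemma gram_scaled n s : (0 < n)%N ->
  gram_mx k R s = diag_mx (\row_p n%:R ^+ #|part p|) *m scaled_gram n s.
Proof.
move=> n0; apply/matrixP => p q; rewrite mul_diag_mx !mxE mulrC divfK //.
by rewrite expf_eq0 pnatr_eq0 eqn0Ngt n0 andbF.
Qed.

Lemma gram_ratio n s : (0 < n)%N -> scaled_gram n n \in unitmx ->
  gram_mx k R n \in unitmx /\
  invmx (gram_mx k R n) *m gram_mx k R s =
  invmx (scaled_gram n n) *m scaled_gram n s.
Proof.
move=> n0 Mu; rewrite !(@gram_scaled n) //.
set D := diag_mx _.
have Du : D \in unitmx.
  rewrite unitmxE det_diag unitfE; apply/prodf_neq0 => p _.
  by rewrite mxE expf_eq0 pnatr_eq0 eqn0Ngt n0 andbF.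
have DMu : D *m scaled_gram n n \in unitmx by rewrite unitmx_mul Du.
split=> //; apply: (can_inj (mulKmx DMu)).
by rewrite mulKVmx // !mulmxA mulmxK.
Qed.

Lemma gram_ratio_near (s : nat -> nat) : \forall n \near \oo,
  [/\ (0 < n)%N, gram_mx k R n \in unitmx & invmx (gram_mx k R n) *m gram_mx k R (s n) =
  invmx (scaled_gram n n) *m scaled_gram n (s n)].
Proof.
have Zu : (zeta_mx k R)^T \in unitmx by rewrite unitmx_tr zeta_mx_unit.
near=> n.
have n0 : (0 < n)%N by near: n; exists 1%N.
have Mu : scaled_gram n n \in unitmx.
  by near: n; apply: cvg_unitmx Zu cvg_scaled_gram_id.
by have [] := gram_ratio (s n) n0 Mu.
Unshelve. all: by end_near. Qed.

Lemma cvg_trace_free_poisson (s : nat -> nat) (t : R) : t != 0 ->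
  (fun n => ratio (s n) n) @ \oo --> t ->
  (fun n => \tr (invmx (gram_mx k R n) *m gram_mx k R (s n))) @ \oo -->
  \sum_(p in NC k) t ^+ #|p|.
Proof.
move=> t0 st.
have Zu : (zeta_mx k R)^T \in unitmx by rewrite unitmx_tr zeta_mx_unit.
apply: (@cvg_trans _ ((fun n => \tr (invmx (scaled_gram n n) *m scaled_gram n (s n))) @ \oo)).
  apply: near_eq_cvg; near=> n.
  by have [//|_ _ ->] := near (gram_ratio_near s) n.
have -> : \sum_(p in NC k) t ^+ #|p| = \sum_p (\row_p t ^+ #|part p|) 0 p.
  by rewrite big_enum_val; apply: eq_bigr => p _; rewrite mxE.
apply: (cvg_trace_ratio Zu cvg_scaled_gram_id) => p q.
by rewrite mxE; apply: cvg_scaled_gram.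
Unshelve. all: by end_near. Qed.

Lemma card_part_gt0 p : (0 < #|part p|)%N.
Proof.
have /and3P[/eqP cov _ _] := NC_partition (enum_valP p).
rewrite lt0n; apply/eqP => /eqP; rewrite cards_eq0 => /eqP p0.
move: cov; rewrite p0 /finset.cover big_set0 => /setP/(_ (Ordinal k0)).
by rewrite !inE.
Qed.

Lemma one_block_partition p : (#|part p| == 1)%N = (part p == [set [set: 'I_k]]%SET).
Proof.
have pP := NC_partition (enum_valP p).
apply/cards1P/eqP => [[B pB]|->]; last by exists [set: 'I_k]%SET.
have /and3P[/eqP cov _ _] := pP.
by rewrite pB; congr [set _]%SET; rewrite -cov pB /finset.cover big_set1.
Qed.

Lemma one_block_NC : [set [set: 'I_k]]%SET \in NC k.
Proof.
have P1 : finset.partition [set [set: 'I_k]]%SET [set: 'I_k].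
  apply/and3P; split.
  - by rewrite /finset.cover big_set1.
  - exact: finset.trivIset1.
  - rewrite inE; apply/eqP => /setP/(_ (Ordinal k0)); by rewrite !inE.
rewrite inE P1 /=; apply/(noncrossingP P1) => a b c d _ _ _ _ _.
by rewrite !(@pblock_of _ _ P1 [set: 'I_k]%SET) ?inE.
Qed.

Lemma finer_one_block p (q : {set {set 'I_k}}) : #|part p| = 1%N -> finer q (part p).
Proof.
move=> /eqP; rewrite one_block_partition => /eqP pE.
have pP := NC_partition (enum_valP p).
by apply/finerP => x y _; rewrite !(@pblock_of _ _ pP [set: 'I_k]%SET) ?pE ?inE.
Qed.

(** After division by [s n / n], the row of [p] is at most of order (s/n)^(|p|-1). Only the
    one-block row survives; its entries are exactly 1 because every partition refines it, and so
    bounded [s] is covered. *)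
Lemma cvg_trace_projection (s : nat -> nat) :
  (\forall n \near \oo, (0 < s n)%N) ->
  (fun n => ratio (s n) n) @ \oo --> (0 : R) ->
  (fun n => (ratio (s n) n)^-1 *
     \tr (invmx (gram_mx k R n) *m gram_mx k R (s n))) @ \oo --> (1 : R).
Proof.
move=> sp st.
have Zu : (zeta_mx k R)^T \in unitmx by rewrite unitmx_tr zeta_mx_unit.
pose Y n := (ratio (s n) n)^-1 *: scaled_gram n (s n).
apply: (@cvg_trans _ ((fun n => \tr (invmx (scaled_gram n n) *m Y n)) @ \oo)).
  apply: near_eq_cvg; near=> n.
  have [//|_ _ ->] := near (gram_ratio_near s) n.
  by rewrite /Y -scalemxAr mxtraceZ.
have -> : (1 : R) = \sum_p (\row_p (#|part p| == 1)%N%:R : 'rV[R]_N) 0 p.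
  have [e eE] : exists e, part e = [set [set: 'I_k]]%SET.
    by exists (enum_rank_in one_block_NC [set [set: 'I_k]]%SET);
      rewrite enum_rankK_in // one_block_NC.
  rewrite (bigD1 e) //= big1 ?addr0 => [|p pe].
    by rewrite mxE one_block_partition eE eqxx.
  rewrite mxE one_block_partition -eE.
  by case: eqP => // /enum_val_inj pE; rewrite pE eqxx in pe.
apply: (cvg_trace_ratio Zu cvg_scaled_gram_id) => p q.
rewrite mxE.
have rn0 : \forall n \near \oo, ratio (s n) n != 0.
  near=> n; rewrite /ratio mulf_neq0 ?invr_eq0 // pnatr_eq0 -lt0n.
    by near: n.
  by near: n; exists 1%N.
have [p1|p1] := eqVneq #|part p| 1%N.
  rewrite mul1r !mxE finer_one_block //; apply: cvg_near_cst; near=> n.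
  rewrite /Y mxE scaled_gram_finer ?finer_one_block // p1 expr1 mulVf //.
  by near: n.
rewrite mul0r.
have [m pm] : exists m, #|part p| = m.+2.
  by move: (card_part_gt0 p) p1; case: #|part p| => [|[|m]] // _ _; exists m.
apply: (@squeeze_cvgr _ _ _ _ (cst 0) (fun n => ratio (s n) n ^+ m.+1)).
- near=> n.
  have r0 : 0 < ratio (s n) n.
    by rewrite lt_def divr_ge0 // andbT; near: n.
  rewrite /Y [X in _ <= X <= _]mxE; apply/andP; split.
    by rewrite mulr_ge0 ?scaled_gram_ge0 // invr_ge0 ltW.
  by rewrite ler_pdivrMl // -exprS -pm scaled_gram_le.
- exact: cvg_cst.
- rewrite (_ : 0 = 0 ^+ m.+1); last by rewrite expr0n.
  by apply: (@continuous_cvg _ _ _ _ _ _ (@GRing.exp R ^~ _)) st; exact: exprn_continuous.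
Unshelve. all: by end_near. Qed.
End GramLimits.

(** * Counting noncrossing partitions *)

Section Motzkin.
Variables (R : comPzRingType) (t : R).

(* Total weight of the Motzkin paths of length [m] from height 0 to height [j],
   with weights 1 (up), 1 + t (level) and t (down). *)
Fixpoint motzkin (m j : nat) : R :=
  if m is m'.+1 then
    (if j is j'.+1 then motzkin m' j' else 0) + (1 + t) * motzkin m' j +
    t * motzkin m' j.+1
  else (j == 0)%:R.

(* Decomposition at the last step from height [j] to height [j.+1]. *)
Lemma motzkin_conv m j :
  motzkin m j.+1 = \sum_(i < m) motzkin i j * motzkin (m.-1 - i) 0.
Proof.
elim: m j => [|m IH] j; first by rewrite big_ord0.
rewrite big_ord_recl /= subn0.
transitivity ((j == 0)%:R * motzkin m 0 +
    \sum_(i < m) motzkin i.+1 j * motzkin (m.-1 - i) 0); last first.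
  congr (_ + _); apply: eq_bigr => i _; congr (_ * motzkin _ _).
  by rewrite /bump /= add1n; case: (m) i => [[]|m' i] //=; rewrite subSS.
have -> : \sum_(i < m) motzkin i.+1 j * motzkin (m.-1 - i) 0 =
   \sum_(i < m) (if j is j'.+1 then motzkin i j' else 0) * motzkin (m.-1 - i) 0
   + (1 + t) * motzkin m j.+1 + t * motzkin m j.+2.
  rewrite !IH !mulr_sumr -!big_split /=; apply: eq_bigr => i _.
  by rewrite !mulrDl !mulrA.
case: j => [|j] /=.
  rewrite mul1r big1 ?add0r ?addrA // => i _; exact: mul0r.
by rewrite mul0r add0r -IH.
Qed.

(** The Narayana polynomials. The shift of index reflects the factor 1/x in the free Poisson
    density: multiplied by x, it becomes a semicircle weight of mass t. *)
Definition narayana (n : nat) : R := if n is m.+1 then t * motzkin m 0 else 1.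

(** The shape met by [nc_sum_rec]: one term for a last point that is a singleton, a convolution for
    a last point with a predecessor in its block. *)
Lemma narayana_rec n : narayana n.+1 =
  t * narayana n + \sum_(i < n) narayana (n.-1 - i) * narayana i.+1.
Proof.
case: n => [|m] /=; first by rewrite big_ord0 addr0.
rewrite big_ord_recr /= subnn mul1r add0r motzkin_conv.
have -> : \sum_(i < m) narayana (m - i) * (t * motzkin i 0) =
    t * (t * \sum_(i < m) motzkin i 0 * motzkin (m.-1 - i) 0).
  rewrite !mulr_sumr; apply: eq_bigr => i _.
  have -> : (m - i = (m.-1 - i).+1)%N.
    by case: (m) i => [[]|m' i] //=; rewrite subSn // -ltnS.
  by rewrite /=; ring.
ring.
Qed.
End Motzkin.

(* A noncrossing partition of the interval [a, b) is encoded by the function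
   sending each point to the least element of its block, and the points
   outside of [a, b) to themselves. *)
Section Canonical.
Variables (R : comPzRingType) (t : R) (N : nat).
Implicit Types (f g : {ffun 'I_N -> 'I_N}) (x y z w j : 'I_N) (a b : nat).

Definition canonical_on a b f : bool :=
  [forall x : 'I_N, [&& f x <= x, f (f x) == f x &
    (f x != x) ==> [&& a <= x, x < b & a <= f x]]]%N.

Definition nc_fun f : bool := [forall x : 'I_N, forall y : 'I_N, forall z : 'I_N, forall w : 'I_N,
  [&& (x < y)%N, (y < z)%N, (z < w)%N, f x == f z & f y == f w] ==> (f x == f y)].

Lemma canonical_onP a b f : reflect
  [/\ forall x, (f x <= x)%N, forall x, f (f x) = f x &
      forall x, f x != x -> [/\ (a <= x)%N, (x < b)%N & (a <= f x)%N]]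
  (canonical_on a b f).
Proof.
apply: (iffP 'forall_and3P) => [h|[h1 h2 h3] x].
  split=> x; have [h1 /eqP h2 /implyP h3] // := h x.
  by move=> /h3 /and3P.
split=> //; first exact/eqP.
by apply/implyP => /h3 /and3P.
Qed.

Lemma nc_funP f : reflect
  (forall x y z w, (x < y)%N -> (y < z)%N -> (z < w)%N ->
     f x = f z -> f y = f w -> f x = f y)
  (nc_fun f).
Proof.
apply: (iffP idP) => [h x y z w xy yz zw /eqP xz /eqP yw|h].
  move/forallP/(_ x)/forallP/(_ y)/forallP/(_ z)/forallP/(_ w): h.
  by rewrite xy yz zw xz yw => /eqP.
apply/forallP => x; apply/forallP => y; apply/forallP => z; apply/forallP => w.
by apply/implyP => /and5P[xy yz zw /eqP xz /eqP yw]; apply/eqP/(h x y z w).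
Qed.

Definition block_count a b f : nat := \sum_(x : 'I_N | (a <= x < b)%N) (f x == x).

Definition nc_sum a b : R :=
  \sum_(f | canonical_on a b f && nc_fun f) t ^+ block_count a b f.

Lemma nc_sum_nil a b : (b <= a)%N -> nc_sum a b = 1.
Proof.
move=> ba; rewrite /nc_sum.
have cid : canonical_on a b [ffun x => x].
  by apply/canonical_onP; split=> x; rewrite !ffunE ?eqxx.
have ncid : nc_fun [ffun x => x].
  apply/nc_funP => x y z w xy yz _; rewrite !ffunE => xz.
  by move: (ltn_trans xy yz); rewrite xz ltnn.
rewrite (bigD1 [ffun x => x]) ?cid //= big1 ?addr0 =>
    [|f /andP[/andP[/canonical_onP[_ _ cf] _] fid]].
  rewrite /block_count big1 // => x /andP[ax xb].
  by have := leq_trans xb (leq_trans ba ax); rewrite ltnn.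
case/eqP: fid; apply/ffunP => x; rewrite ffunE; apply/eqP; apply: contraT => /cf[ax xb _].
by have := leq_trans xb (leq_trans ba ax); rewrite ltnn.
Qed.

Section Step.
Variables (a : nat) (M : 'I_N).
Hypothesis aM : (a <= M)%N.

Lemma canonical_on_fix f :
  canonical_on a M.+1 f && (f M == M) = canonical_on a M f.
Proof.
apply/andP/canonical_onP => [[/canonical_onP[h1 h2 h3] /eqP fM]|[h1 h2 h3]].
  split=> // x fx; have [ax xM afx] := h3 x fx; split=> //.
  move: xM; rewrite ltnS leq_eqVlt => /orP[/eqP/val_inj xM|//].
  by move: fx; rewrite xM fM eqxx.
split; last by apply: contraT => /h3[_]; rewrite ltnn.
by apply/canonical_onP; split=> // x /h3[ax xM afx]; split=> //; apply: ltnW.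
Qed.

Lemma block_count_recr f :
  block_count a M.+1 f = (block_count a M f + (f M == M))%N.
Proof.
rewrite /block_count (bigD1 M) /=; last by rewrite aM leqnn.
rewrite addnC; congr (_ + _)%N; apply: eq_bigl => x.
rewrite ltnS [(x <= M)%N]leq_eqVlt -andbA; congr (_ && _).
by rewrite -val_eqE /=; case: ltngtP.
Qed.

Lemma nc_sum_singleton :
  \sum_(f | canonical_on a M.+1 f && nc_fun f && (f M == M))
     t ^+ block_count a M.+1 f = t * nc_sum a M.
Proof.
rewrite /nc_sum mulr_sumr; apply: eq_big => [f|f].
  by rewrite andbAC canonical_on_fix.
by move=> /andP[_ fM]; rewrite block_count_recr fM addn1 exprS.
Qed.

(** The point just before [M] in its block. By noncrossing, the points strictly between [j] and [M]
    are partitioned among themselves, so the interval splits at [j]. *)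
Definition previous f (j : 'I_N) : bool :=
  [&& (j < M)%N, f j == f M & [forall x : 'I_N, (j < x < M)%N ==> (f x != f M)]].

Lemma previousP f j : reflect
  [/\ (j < M)%N, f j = f M & forall x, (j < x)%N -> (x < M)%N -> f x <> f M]
  (previous f j).
Proof.
apply: (iffP and3P) => -[jM fj h]; split=> //.
- exact/eqP.
- by move=> x jx xM; apply/eqP; move/forallP/(_ x): h; rewrite jx xM.
- exact/eqP.
- by apply/forallP => x; apply/implyP => /andP[jx xM]; apply/eqP/h.
Qed.

Lemma previous_exists f : canonical_on a M.+1 f -> f M != M ->
  exists j, previous f j.
Proof.
move=> /canonical_onP[h1 h2 h3] fM.
have P0 : ((f M < M)%N && (f (f M) == f M)).
  by rewrite ltn_neqAle h1 fM h2 eqxx.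
pose P (x : 'I_N) := (x < M)%N && (f x == f M).
have [j /andP[jM /eqP fj] jmax] := @arg_maxnP _ (f M) P (fun x => x : nat) P0.
exists j; apply/previousP; split=> // x jx xM fx.
have /jmax /= : P x by rewrite /P xM fx eqxx.
by rewrite leqNgt jx.
Qed.

Lemma previous_unique f j j' : previous f j -> previous f j' -> j = j'.
Proof.
move=> /previousP[jM fj hj] /previousP[j'M fj' hj'].
by apply: val_inj; case: (ltngtP j j') => // [/hj/(_ j'M)|/hj'/(_ jM)].
Qed.

Lemma previous_ge f j : canonical_on a M.+1 f -> previous f j -> f M != M ->
  (a <= j)%N.
Proof.
move=> /canonical_onP[h1 h2 h3] /previousP[jM fj _] /h3[_ _ afM].
by apply: leq_trans afM _; rewrite -fj.
Qed.

Section Glue.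
Variable j : 'I_N.
Hypotheses (aj : (a <= j)%N) (jM : (j < M)%N).

(** [fg.1] governs the points strictly between [j] and [M], [fg.2] those up to [j], and [M] joins
    the block of [j], whose least element is [fg.2 j]. *)
Definition glue (fg : {ffun 'I_N -> 'I_N} * {ffun 'I_N -> 'I_N}) : {ffun 'I_N -> 'I_N} :=
  [ffun x : 'I_N => if x == M then fg.2 j else if (x <= j)%N then fg.2 x else fg.1 x].

Definition unglue f : {ffun 'I_N -> 'I_N} * {ffun 'I_N -> 'I_N} :=
  ([ffun x : 'I_N => if (j < x < M)%N then f x else x],
   [ffun x : 'I_N => if (a <= x <= j)%N then f x else x]).

Definition glue_dom (fg : {ffun 'I_N -> 'I_N} * {ffun 'I_N -> 'I_N}) : bool :=
  (canonical_on j.+1 M fg.1 && nc_fun fg.1) && (canonical_on a j.+1 fg.2 && nc_fun fg.2).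

Lemma glueK fg : glue_dom fg -> unglue (glue fg) = fg.
Proof.
case: fg => f1 f2 /andP[/andP[/canonical_onP[l1 i1 r1] nc1] /andP[/canonical_onP[l2 i2 r2] nc2]].
rewrite /unglue /glue /=; congr pair; apply/ffunP => x; rewrite !ffunE /=.
  have [/andP[jx xM]|xN] := boolP (j < x < M)%N.
    by rewrite -val_eqE ltn_eqF // leqNgt jx.
  by apply/esym/eqP; apply: contraNT xN => /r1[-> -> _].
have [/andP[ax xj]|xN] := boolP (a <= x <= j)%N.
  by rewrite -val_eqE ltn_eqF ?xj // (leq_ltn_trans xj).
by apply/esym/eqP; apply: contraNT xN => /r2[-> xj _]; rewrite -ltnS.
Qed.

Lemma unglueK f : canonical_on a M.+1 f -> previous f j -> glue (unglue f) = f.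
Proof.
move=> /canonical_onP[l i r] /previousP[_ fj _].
apply/ffunP => x; rewrite !ffunE /=.
have [->|xM] := eqVneq x M; first by rewrite aj leqnn fj.
have [xj|jx] := leqP x j.
  rewrite andbT; have [//|xa] := leqP a x.
  by apply/esym/eqP; apply: contraT => /r[ax _ _]; rewrite leqNgt xa in ax.
rewrite ?jx /=; have [//|Mx] := ltnP x M.
apply/esym/eqP; apply: contraT => /r[_]; rewrite ltnS leq_eqVlt => /orP[|].
  by rewrite val_eqE (negbTE xM).
by rewrite ltnNge Mx.
Qed.

Lemma glue_canonical fg : glue_dom fg ->
  canonical_on a M.+1 (glue fg) && nc_fun (glue fg) && (glue fg M != M) && previous (glue fg) j.
Proof.
case: fg => f1 f2 /andP[/andP[/canonical_onP[l1 i1 r1] /nc_funP nc1]].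
move=> /andP[/canonical_onP[l2 i2 r2] /nc_funP nc2].
have jnM x : (x <= j)%N -> (x == M) = false.
  by move=> xj; rewrite -val_eqE ltn_eqF // (leq_ltn_trans xj).
have le2 x : (x <= j)%N -> (f2 x <= j)%N by apply: leq_trans.
have gt1 x : (j < x)%N -> (j < f1 x)%N.
  by move=> jx; have [->//|/r1[]//] := eqVneq (f1 x) x.
have nM1 x : (x == M) = false -> (f1 x == M) = false.
  have [->//|/r1[_ xM _] _] := eqVneq (f1 x) x.
  by rewrite -val_eqE ltn_eqF // (leq_ltn_trans (l1 x)).
set g := glue _.
have gM : g M = f2 j by rewrite ffunE eqxx.
have gj x : (x <= j)%N -> g x = f2 x by move=> xj; rewrite ffunE jnM // xj.
have gn x : (x == M) = false -> (j < x)%N -> g x = f1 x.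
  by move=> xM jx; rewrite ffunE xM leqNgt jx.
have region x : [\/ x = M, (x <= j)%N | ((x == M) = false) /\ (j < x)%N].
  have [->|/negbTE xM] := eqVneq x M; first exact: Or31.
  by have [xj|jx] := leqP x j; [exact: Or32|exact: Or33].
have gnj x : (x == M) = false -> (j < x)%N -> (j < g x)%N.
  by move=> xM jx; rewrite gn // gt1.
have gle x : (g x <= j)%N -> x = M \/ (x <= j)%N.
  case: (region x) => [->|xj|[xM jx]]; [by left|by right|].
  by rewrite leqNgt gnj.
have cg : canonical_on a M.+1 g.
  apply/canonical_onP; split=> x; case: (region x) => [->|xj|[xM jx]].
  - by rewrite gM (leq_trans (le2 _ (leqnn j))) // ltnW.
  - by rewrite gj.
  - by rewrite gn.
  - by rewrite gM gj ?le2.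
  - by rewrite !gj ?le2.
  - by rewrite !gn ?nM1 ?gt1 // gn.
  - move=> _; rewrite leqnn aM gM; split=> //.
    by have [->|/r2[]] := eqVneq (f2 j) j.
  - rewrite gj // => /r2[ax _ ->]; split=> //.
    by rewrite ltnS (leq_trans xj) // ltnW.
  - rewrite gn // => /r1[_ xM' afx]; split=> //.
    + by rewrite (leq_trans aj) // ltnW.
    + exact: ltnW.
    + by rewrite (leq_trans aj) // ltnW.
have ncg : nc_fun g.
  apply/nc_funP => x y z w xy yz zw gxz gyw.
  have xz := ltn_trans xy yz; have yw := ltn_trans yz zw.
  case: (region w) => [wM|wj|[wM jw]].
  - have nM (u : 'I_N) : (u < w)%N -> (u == M) = false.
      by move=> uw; rewrite -val_eqE ltn_eqF // -wM.
    have yj : (y <= j)%N.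
      have [||//] := gle y; first by rewrite gyw wM gM le2.
      by move=> yM; have := nM y yw; rewrite yM eqxx.
    have xj : (x <= j)%N by rewrite (leq_trans _ yj) // ltnW.
    have zj : (z <= j)%N.
      have [||//] := gle z; first by rewrite -gxz gj // le2.
      by move=> zM; have := nM z zw; rewrite zM eqxx.
    move: gxz gyw; rewrite wM gM !gj // => gxz gyw.
    (* As [M] lies in the block of [j], the crossing x, y, z, M becomes x, y, z, j, unless [z = j],
       when the two blocks are the same. *)
    move: zj; rewrite leq_eqVlt => /orP[/eqP/val_inj zE|zj].
      by rewrite gxz gyw zE.
    exact: (nc2 x y z j).
  - have zj : (z <= j)%N by rewrite (leq_trans _ wj) // ltnW.
    have yj : (y <= j)%N by rewrite (leq_trans _ zj) // ltnW.
    have xj : (x <= j)%N by rewrite (leq_trans _ yj) // ltnW.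
    by move: gxz gyw; rewrite !gj //; apply: nc2 xy yz zw.
  - have gw : (j < g y)%N by rewrite gyw gnj.
    case: (region y) => [yM|yj|[yM jy]].
    + by move: gw; rewrite yM gM ltnNge le2.
    + by move: gw; rewrite gj // ltnNge le2.
    case: (region z) => [zM|zj|[zM jz]].
    + have fw : f1 w = w.
        apply/eqP; apply: contraT => /r1[_ wM' _].
        by move: zw; rewrite zM ltnNge ltnW.
      move: gyw; rewrite (gn y) // (gn w) // fw => yE.
      by have := l1 y; rewrite yE leqNgt yw.
    + by move: (leq_trans yz zj); rewrite ltnNge ltnW.
    have gz : (j < g x)%N by rewrite gxz gnj.
    case: (region x) => [xM|xj|[xM jx]].
    + by move: gz; rewrite xM gM ltnNge le2.
    + by move: gz; rewrite gj // ltnNge le2.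
    by move: gxz gyw; rewrite !gn //; apply: nc1 xy yz zw.
rewrite cg ncg /=; apply/andP; split.
  by rewrite gM -val_eqE ltn_eqF // (leq_ltn_trans (le2 _ (leqnn j))).
apply/previousP; split=> //; first by rewrite gj // gM.
move=> x jx xM; have xM' : (x == M) = false by rewrite -val_eqE ltn_eqF.
move=> e; have := gnj x xM' jx; rewrite e gM ltnNge le2 //.
Qed.

Lemma unglue_dom f : canonical_on a M.+1 f -> nc_fun f -> f M != M -> previous f j ->
  glue_dom (unglue f).
Proof.
move=> /canonical_onP[l i r] /nc_funP nc fM /previousP[_ fj pj].
(* A block meeting the gap cannot start before [j], as it would cross the block of [j] and [M]; nor
   at [j], since [j] is the last point of that block before [M]. *)
have up x : (j < x)%N -> (x < M)%N -> (j < f x)%N.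
  move=> jx xM; rewrite ltnNge leq_eqVlt; apply/negP => /orP[/eqP/val_inj fxj|fxj].
    by apply: (pj x) => //; rewrite -fj -fxj i.
  apply: (pj x) => //; rewrite -fj -[LHS]i.
  exact: (nc (f x) j x M).
have low x : (a <= x)%N -> (a <= f x)%N.
  by have [->//|/r[]] := eqVneq (f x) x.
apply/andP; split; apply/andP; rewrite /unglue /=; set g := finfun _.
- have gE x : g x = if (j < x < M)%N then f x else x by rewrite ffunE.
  have gle x : (g x <= x)%N by rewrite gE; case: ifP.
  have rng x y : (x < y)%N -> g x = g y -> (j < x < M)%N /\ (j < y < M)%N.
    move=> xy e; have yr : (j < y < M)%N.
      apply: contraT => yr; have := gle x; rewrite e gE (negbTE yr).
      by rewrite leqNgt xy.
    split=> //; apply: contraT => xr; move: e; rewrite !gE yr (negbTE xr) => e.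
    case/negP: xr; move: yr => /andP[jy yM].
    by rewrite (ltn_trans xy yM) e up.
  split.
    apply/canonical_onP; split=> // x.
      rewrite [g x]gE; case: ifP => [/andP[jx xM]|xr]; last by rewrite gE xr.
      by rewrite gE up // (leq_ltn_trans (l x)) //= i.
    rewrite gE; case: ifP => [/andP[jx xM] _|]; last by rewrite eqxx.
    by split=> //; exact: up.
  apply/nc_funP => x y z w xy yz zw gxz gyw.
  have [xr zr] := rng _ _ (ltn_trans xy yz) gxz.
  have [yr wr] := rng _ _ (ltn_trans yz zw) gyw.
  by move: gxz gyw; rewrite !gE xr yr zr wr; apply: nc xy yz zw.
- have gE x : g x = if (a <= x <= j)%N then f x else x by rewrite ffunE.
  have gle x : (g x <= x)%N by rewrite gE; case: ifP.
  have rng x y : (x < y)%N -> g x = g y -> (a <= x <= j)%N /\ (a <= y <= j)%N.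
    move=> xy e; have yr : (a <= y <= j)%N.
      apply: contraT => yr; have := gle x; rewrite e gE (negbTE yr).
      by rewrite leqNgt xy.
    split=> //; apply: contraT => xr; move: e; rewrite !gE yr (negbTE xr) => e.
    case/negP: xr; move: yr => /andP[ay yj].
    by rewrite (leq_trans (ltnW xy) yj) e low.
  split.
    apply/canonical_onP; split=> // x.
      rewrite [g x]gE; case: ifP => [/andP[ax xj]|xr]; last by rewrite gE xr.
      by rewrite gE low // (leq_trans (l x)) //= i.
    rewrite gE; case: ifP => [/andP[ax xj] _|]; last by rewrite eqxx.
    by split=> //; exact: low.
  apply/nc_funP => x y z w xy yz zw gxz gyw.
  have [xr zr] := rng _ _ (ltn_trans xy yz) gxz.
  have [yr wr] := rng _ _ (ltn_trans yz zw) gyw.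
  by move: gxz gyw; rewrite !gE xr yr zr wr; apply: nc xy yz zw.
Qed.

(** Blocks are counted by their least elements, and [M] is not the least element of its block. *)
Lemma block_count_glue fg : glue_dom fg ->
  block_count a M.+1 (glue fg) = (block_count j.+1 M fg.1 + block_count a j.+1 fg.2)%N.
Proof.
move=> fgd; have /andP[/andP[_ gM] _] := glue_canonical fgd.
rewrite block_count_recr (negbTE gM) addn0 /block_count.
rewrite (bigID (fun x : 'I_N => (x <= j)%N)) /= addnC; congr (_ + _)%N.
  apply: eq_big => [x|x /andP[/andP[_ xM] xj]].
    rewrite -ltnNge andbC andbA; congr (_ && _).
    by rewrite andb_idr // => jx; rewrite (leq_trans aj) // ltnW.
  have xMF : (x == M) = false by rewrite -val_eqE ltn_eqF.
  by rewrite ffunE xMF (negbTE xj).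
apply: eq_big => [x|x /andP[/andP[_ xM] xj]].
  rewrite ltnS -andbA; congr (_ && _).
  by rewrite andb_idl // => xj; apply: leq_ltn_trans xj jM.
have xMF : (x == M) = false by rewrite -val_eqE ltn_eqF.
by rewrite ffunE xMF xj.
Qed.

Lemma nc_sum_previous :
  \sum_(f | canonical_on a M.+1 f && nc_fun f && (f M != M) && previous f j)
     t ^+ block_count a M.+1 f = nc_sum j.+1 M * nc_sum a j.+1.
Proof.
rewrite /nc_sum big_distrlr /= pair_big_dep /=.
rewrite (reindex_onto glue unglue) /=; last first.
  by move=> f /andP[/andP[/andP[cf _] _] pf]; apply: unglueK.
apply: eq_big => [fg|fg /andP[zP /eqP zE]].
  apply/andP/idP => [[zP /eqP <-]|zd]; last by rewrite glue_canonical ?glueK.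
  by move: zP => /andP[/andP[/andP[cf ncf] fM] pf]; apply: unglue_dom.
have zd : glue_dom fg.
  by rewrite -zE; move: zP => /andP[/andP[/andP[cf ncf] fM] pf]; apply: unglue_dom.
by rewrite block_count_glue // exprD.
Qed.
End Glue.

(** [M] is the last point, so [f M = M] means that it forms a block by itself, whence the factor
    [t]. Otherwise the sum is split according to its predecessor. *)
Lemma nc_sum_rec : nc_sum a M.+1 =
  t * nc_sum a M + \sum_(j : 'I_N | (a <= j < M)%N) nc_sum j.+1 M * nc_sum a j.+1.
Proof.
rewrite {1}/nc_sum (bigID (fun f : {ffun 'I_N -> 'I_N} => f M == M)) /=.
rewrite nc_sum_singleton; congr (_ + _).
under [RHS]eq_bigr => j /andP[aj jM] do rewrite -(nc_sum_previous aj jM).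
(* The default [M] is never reached: [previous_exists] supplies a predecessor when [f M != M]. *)
pose nx (f : {ffun 'I_N -> 'I_N}) := odflt M [pick j | previous f j].
rewrite (partition_big nx (fun j : 'I_N => (a <= j < M)%N)) /=.
  apply: eq_bigr => j _; apply: eq_bigl => f.
  have [/andP[/andP[cf ncf] fM] /=|//] := boolP (_ && _ && (_ != _)).
  rewrite /nx; case: pickP => [j' pj'|none] /=.
    by apply/eqP/idP => [<-//|pj]; apply: previous_unique pj.
  by have [j' pj'] := previous_exists cf fM; rewrite none in pj'.
move=> f /andP[/andP[cf ncf] fM]; rewrite /nx.
case: pickP => [j pj|none] /=.
  by rewrite (previous_ge cf pj fM); case/previousP: pj.
by have [j' pj'] := previous_exists cf fM; rewrite none in pj'.
Qed.
End Step.

Lemma nc_sum_narayana a b : (b <= N)%N -> nc_sum a b = narayana t (b - a).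
Proof.
have [m] := ubnP (b - a); elim: m a b => // m IH a [|b] bm bN.
  by rewrite nc_sum_nil.
have [ba|ab] := ltnP b a.
  by rewrite nc_sum_nil // (eqP (_ : b.+1 - a == 0)%N) // subn_eq0.
move: bm; rewrite subSn // ltnS => bm.
rewrite [LHS](@nc_sum_rec a (Ordinal bN) ab) narayana_rec.
congr (_ * _ + _); first by apply: IH => //; exact: ltnW.
pose G i := nc_sum i.+1 b * nc_sum a i.+1.
transitivity (\sum_(a <= i < b) G i).
  rewrite big_geq_mkord (big_ord_widen_cond N (fun i => (a <= i)%N) G) //=.
  exact: ltnW.
rewrite -{1}[a]add0n big_addn big_mkord; apply: eq_bigr => i _.
have ib : (i + a < b)%N by rewrite addnC -ltn_subRL.
rewrite /G !IH ?(ltnW bN) //.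
  by congr (narayana _ _ * narayana _ _); lia.
all: lia.
Qed.
End Canonical.

Section NoncrossingSum.
Variables (R : comPzRingType) (t : R) (k : nat).
Implicit Types (f : {ffun 'I_k -> 'I_k}) (p : {set {set 'I_k}}).

(** Inverse to [ker_part]: it matches the partitions with the canonical functions on the whole
    interval. *)
Definition block_min p : {ffun 'I_k -> 'I_k} :=
  [ffun x => [arg min_(y < x | y \in finset.pblock p x) (y : nat)]].

Section BlockMin.
Variable p : {set {set 'I_k}}.
Hypothesis pP : finset.partition p [set: 'I_k].

Lemma block_minP x : block_min p x \in finset.pblock p x /\
  forall y, y \in finset.pblock p x -> (block_min p x <= y)%N.
Proof.
rewrite ffunE; case: arg_minnP => [|y yx ymin]; first exact: mem_pblock_part.
by split.
Qed.

Lemma pblock_block_min x : finset.pblock p (block_min p x) = finset.pblock p x.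
Proof. by apply/esym/eqP; rewrite same_block //; case: (block_minP x). Qed.

Lemma block_min_eq x y : (block_min p x == block_min p y) =
  (finset.pblock p x == finset.pblock p y).
Proof.
apply/eqP/eqP => [e|e].
  by rewrite -pblock_block_min e pblock_block_min.
have [xin xmin] := block_minP x; have [yin ymin] := block_minP y.
by apply/val_inj/anti_leq; rewrite xmin ?ymin // ?e // -e.
Qed.

Lemma ker_block_min : ker_part (block_min p) = p.
Proof.
apply: finer_anti (ker_partP _) pP _ _; apply/finerP => x y /eqP.
  by rewrite pblock_ker block_min_eq => /eqP.
by rewrite -block_min_eq -pblock_ker => /eqP.
Qed.
End BlockMin.

Lemma canonical_block_min p : finset.partition p [set: 'I_k] ->
  canonical_on 0 k (block_min p).
Proof.
move=> pP; apply/canonical_onP; split=> x.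
- by have [_] := block_minP pP x; apply; apply: mem_pblock_part.
- by apply/eqP; rewrite block_min_eq // pblock_block_min.
- by [].
Qed.

Lemma block_min_ker f : canonical_on 0 k f -> block_min (ker_part f) = f.
Proof.
move=> /canonical_onP[l i _]; apply/ffunP => x.
have pP := ker_partP f; have [xin xmin] := block_minP pP x.
move: xin; rewrite -same_block // pblock_ker => /eqP fx.
have le1 : (block_min (ker_part f) x <= f x)%N.
  by apply: xmin; rewrite -same_block // pblock_ker i.
have le2 : (f x <= block_min (ker_part f) x)%N by rewrite fx l.
by apply/val_inj/anti_leq; rewrite le1 le2.
Qed.

Lemma noncrossing_ker f : noncrossing (ker_part f) = nc_fun f.
Proof.
apply/(noncrossingP (ker_partP f))/nc_funP => h x y z w xy yz zw xz yw.
  by apply/eqP; rewrite -pblock_ker; apply/eqP; apply: (h x y z w) => //;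
    apply/eqP; rewrite pblock_ker; apply/eqP.
apply/eqP; rewrite pblock_ker; apply/eqP; apply: (h x y z w) => //;
  by apply/eqP; rewrite -pblock_ker; apply/eqP.
Qed.

Lemma card_ker_part f : canonical_on 0 k f -> #|ker_part f| = block_count 0 k f.
Proof.
move=> /canonical_onP[_ i _]; have pP := ker_partP f.
have -> : block_count 0 k f = #|[set x | f x == x]%SET|.
  rewrite -sum1_card /block_count [RHS]big_mkcond /=.
  by apply: eq_big => [x|x _]; rewrite ?ltn_ord // inE; case: eqP.
rewrite -(@card_in_imset _ _ (finset.pblock (ker_part f))).
  apply: eq_card => B; apply/idP/imsetP => [Bp|[x _ ->]]; last exact: pblock_in.
  have [x xB] := block_inhabited pP Bp.
  exists (f x); first by rewrite inE i.
  apply/esym; rewrite -(pblock_of pP Bp xB).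
  by apply/eqP; rewrite pblock_ker i.
move=> x y; rewrite !inE => /eqP fx /eqP fy /eqP.
by rewrite pblock_ker fx fy => /eqP.
Qed.

Lemma sum_NC : \sum_(p in NC k) t ^+ #|p| = narayana t k.
Proof.
rewrite -[k in RHS]subn0 -(@nc_sum_narayana _ t k 0 k) // /nc_sum.
rewrite (reindex_onto (@ker_part k k) block_min) /=; last first.
  by move=> p /NC_partition; apply: ker_block_min.
apply: eq_big => [f|f /andP[_ /eqP fE]].
  rewrite inE ker_partP noncrossing_ker /=.
  apply/andP/andP => [[ncf /eqP <-]|[cf ncf]]; last by rewrite block_min_ker ?eqxx.
  split; first exact/canonical_block_min/ker_partP.
  by rewrite -noncrossing_ker ker_block_min ?noncrossing_ker ?ker_partP.
by rewrite card_ker_part // -fE; apply/canonical_block_min/ker_partP.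
Qed.
End NoncrossingSum.

(** * Moments of the free Poisson law *)

(* The map [phi] is only ever the identity between the two copies of the
   measurable space of real numbers. *)
Section Density.
Context d d' (T : measurableType d) (U : measurableType d') (R : realType).
Variables (mu : {measure set T -> \bar R}) (nu : {measure set U -> \bar R}).
Variables (phi : T -> U) (g : T -> R).
Hypotheses (mphi : measurable_fun setT phi) (mg : measurable_fun setT g).
Hypothesis g0 : forall x, 0 <= g x.
Hypothesis nuE : forall A, measurable A ->
  nu A = (\int[mu]_(x in phi @^-1` A) (g x)%:E)%E.
Local Open Scope ereal_scope.
Import HBNNSimple.

(** Monotone approximation by simple functions on both sides leaves the case of an indicator, which
    is [nuE]. *)
Lemma ge0_integral_density (f : U -> \bar R) : measurable_fun setT f ->
  (forall y, 0 <= f y) ->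
  \int[nu]_y f y = \int[mu]_x (f (phi x) * (g x)%:E).
Proof.
move=> mf f0; pose h := nnsfun_approx measurableT mf.
have mgE : measurable_fun setT (fun x => (g x)%:E) by exact/measurable_EFinP.
have mhphi n : measurable_fun setT (fun x => (h n (phi x))%:E).
  by apply/measurable_EFinP; apply: measurableT_comp.
have fE y : f y = lim ((EFin \o h n) y @[n --> \oo]).
  by apply/esym/cvg_lim => //; exact: cvg_nnsfun_approx.
have -> : \int[nu]_y f y = lim (\int[nu]_y (EFin \o h n) y @[n --> \oo]).
  under eq_integral => y _ do rewrite fE.
  apply: monotone_convergence => //.
  - by move=> n; apply/measurable_EFinP.
  - by move=> n y _ //=; rewrite lee_fin.
  - by move=> y _ a b ab; rewrite lee_fin; exact/lefP/nd_nnsfun_approx.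
have -> : \int[mu]_x (f (phi x) * (g x)%:E) =
    lim (\int[mu]_x ((h n (phi x))%:E * (g x)%:E) @[n --> \oo]).
  have fg x : f (phi x) * (g x)%:E = lim (((h n (phi x))%:E * (g x)%:E) @[n --> \oo]).
    by apply/esym/cvg_lim => //; apply: cvgeZr => //; exact: cvg_nnsfun_approx.
  under eq_integral => x _ do rewrite fg.
  apply: monotone_convergence => //.
  - by move=> n; apply: emeasurable_funM.
  - by move=> n x _ /=; rewrite mule_ge0 ?lee_fin.
  - by move=> x _ a b ab/=; rewrite lee_wpmul2r ?lee_fin ?g0//; exact/lefP/nd_nnsfun_approx.
suff suf n : \int[mu]_x ((h n (phi x))%:E * (g x)%:E) = \int[nu]_y (EFin \o h n) y.
  by under [in RHS]eq_fun do rewrite suf.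
transitivity (\int[nu]_y
   (\sum_(z \in range (h n)) (z * \1_(h n @^-1` [set z]) y)%:E)); last first.
  by apply: eq_integral => y _; rewrite /= fimfunE -fsumEFin.
have mindic r : measurable_fun setT (fun y => (r * \1_(h n @^-1` [set r]) y)%:E).
  by apply/measurable_EFinP; exact: measurable_funM.
have mindic_phi r : measurable_fun setT (fun x => (r * \1_(h n @^-1` [set r]) (phi x))%:E).
  exact: (measurableT_comp (mindic r)).
rewrite ge0_integral_fsum//; last by move=> z y _; exact: nnfun_muleindic_ge0.
transitivity (\int[mu]_x (\sum_(z \in range (h n))
    (z * \1_(h n @^-1` [set z]) (phi x))%:E * (g x)%:E)).
  apply: eq_integral => x _.
  rewrite -ge0_mule_fsuml => [|z]; last exact: nnfun_muleindic_ge0.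
  by rewrite fsumEFin // -(fimfunE _ (phi x)).
rewrite ge0_integral_fsum//; last 2 first.
  - by move=> z; apply: emeasurable_funM.
  - move=> z x _; apply: mule_ge0; last by rewrite lee_fin.
    by rewrite EFinM nnfun_muleindic_ge0.
apply: eq_fsbigr => r rhn.
under [RHS]eq_integral do rewrite EFinM.
rewrite integralZl_indic_nnsfun => //.
under eq_integral do rewrite EFinM -muleA.
have mpre : measurable (phi @^-1` (h n @^-1` [set r])).
  by rewrite -[X in measurable X]setTI; apply: mphi.
have mind1 : measurable_fun setT (fun x => (\1_(h n @^-1` [set r]) (phi x) : R)%:E).
  by apply/measurable_EFinP; apply: (measurableT_comp _ mphi).
rewrite ge0_integralZl//.
- under eq_integral do rewrite muleC.
  rewrite (eq_integral ((EFin \o g) \_ (phi @^-1` (h n @^-1` [set r])))); last first.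
    by move=> x xE; rewrite epatch_indic.
  by rewrite -integral_mkcondr setTI -nuE // integral_indic // setIT.
- by apply: emeasurable_funM.
- by move=> x _; rewrite mule_ge0 ?lee_fin.
- by move: rhn; rewrite inE => -[x _ <-]; rewrite lee_fin.
Qed.
End Density.

Section FreePoissonIntegral.
Variable R : realType.
Local Notation leb := (@lebesgue_measure R).
Variables (t : R) (ht : 0 < t <= 1).

Lemma ge0_integral_free_poisson (f : R -> \bar R) : measurable_fun setT f ->
  (forall x, 0 <= f x)%E ->
  (\int[free_poisson ht]_x f x =
   (1 - t)%:E * f 0%R + \int[leb]_x (f x * (free_poisson_pdf t x)%:E))%E.
Proof.
move=> mf f0; rewrite /free_poisson ge0_integral_measure_add //.
rewrite ge0_integral_mscale // integral_dirac // diracT mul1e.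
congr (_ + _)%E.
apply: (@ge0_integral_density _ _ (measurableTypeR R) _ R leb (free_poisson_ac t)
  idfun (free_poisson_pdf t)) => //.
- by move=> _ Y mY; rewrite setTI.
- exact: measurable_free_poisson_pdf.
- exact: free_poisson_pdf_ge0.
Qed.

Lemma free_poisson_pdf_neg x : x < 0 -> free_poisson_pdf t x = 0.
Proof.
move=> x0; rewrite /free_poisson_pdf; case: ifP => // /andP[h _].
by move: (lt_le_trans x0 (sqr_ge0 (1 - Num.sqrt t))); rewrite ltNge h.
Qed.

(** A positive power kills the atom at 0, and the density vanishes on the negative axis, so the
    negative part integrates to 0 and the nonnegative case applies. *)
Lemma integral_free_poisson_exp m :
  (\int[free_poisson ht]_x (x ^+ m.+1)%:E =
   \int[leb]_x (x ^+ m.+1 * free_poisson_pdf t x)%:E)%E.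
Proof.
have mf : measurable_fun [set: R] (fun x => (x ^+ m.+1)%:E : \bar R).
  by apply/measurable_EFinP; exact: measurable_funX.
rewrite integralE ge0_integral_free_poisson //; last exact: measurable_funepos.
rewrite ge0_integral_free_poisson //; last exact: measurable_funeneg.
have f00 : ((0 : R) ^+ m.+1)%:E = 0%E by rewrite expr0n.
rewrite [X in (_ - X)%E](_ : _ = 0)%E; last first.
  rewrite funenegE f00 oppe0 maxxx mule0 add0e.
  apply: integral0_eq => x _; rewrite funenegE; have [x0|x0] := ltP x 0.
    by rewrite free_poisson_pdf_neg // mule0.
  rewrite (max_idPr _) ?mul0e // leeNl oppe0 lee_fin.
  by rewrite exprn_ge0.
rewrite sube0 funeposE f00 maxxx mule0 add0e.
apply: eq_integral => x _; rewrite funeposE; have [x0|x0] := ltP x 0.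
  by rewrite free_poisson_pdf_neg // mule0 mulr0.
by rewrite (max_idPl _) -?EFinM // lee_fin exprn_ge0.
Qed.
End FreePoissonIntegral.

Section SineExpansion.
Variable R : realType.
Implicit Types (r c theta : R).

Lemma motzkin_gt (t : R) m j : (m < j)%N -> motzkin t m j = 0.
Proof.
elim: m j => [|m IH] [|j] //= mj.
by rewrite !IH ?mulr0 ?addr0 // ltnW // ltnW.
Qed.

(* The Chebyshev recurrence [2 cos x sin ((j+1) x) = sin ((j+2) x) + sin (j x)]
   turns multiplication by [c + 2 r cos x] into a step of the Motzkin path. *)
Lemma sine_expansion r theta m :
  (1 + r ^+ 2 + 2 * r * cos theta) ^+ m * sin theta =
  \sum_(j < m.+1) r ^+ j * motzkin (r ^+ 2) m j * sin (j.+1%:R * theta).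
Proof.
set t := r ^+ 2.
have step (j : nat) : 2 * cos theta * sin (j.+1%:R * theta) =
    sin (j.+2%:R * theta) + sin (j%:R * theta).
  have -> : j.+2%:R * theta = j.+1%:R * theta + theta by rewrite -natr1; ring.
  have -> : j%:R * theta = j.+1%:R * theta - theta by rewrite -natr1; ring.
  by rewrite sinD sinB; ring.
elim: m => [|m IH].
  by rewrite big_ord_recl big_ord0 /= !expr0 !mul1r addr0.
rewrite exprS -mulrA IH.
pose a j := r ^+ j * motzkin t m j; pose S j := sin (j%:R * theta).
have S0 : S 0%N = 0 by rewrite /S mul0r sin0.
have amax j : (m < j)%N -> a j = 0 by move=> mj; rewrite /a motzkin_gt ?mulr0.
transitivity (\sum_(j < m.+1) (r * (a j * S j.+2) + ((1 + t) * (a j * S j.+1)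
    + r * (a j * S j)))).
  rewrite mulr_sumr; apply: eq_bigr => j _; rewrite -/(a j) -/(S j.+1).
  have := step j; rewrite -/(S j.+1) -/(S j.+2) -/(S j) => e.
  transitivity ((1 + t) * (a j * S j.+1) + r * a j * (2 * cos theta * S j.+1)).
    by ring.
  by rewrite e; ring.
rewrite !big_split /=.
transitivity (\sum_(j < m.+2)
    (r ^+ j * (if (j : nat) is j'.+1 then motzkin t m j' else 0) * S j.+1) +
    (\sum_(j < m.+2) (1 + t) * (a j * S j.+1) + \sum_(j < m.+2) r * (a j.+1 * S j.+1))).
  congr (_ + (_ + _)).
  - rewrite [RHS]big_ord_recl /= mulr0 mul0r add0r; apply: eq_bigr => j _.
    by rewrite /bump /= add1n /a exprS; ring.
  - by rewrite [RHS]big_ord_recr /= amax // mul0r mulr0 addr0.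
  - rewrite big_ord_recl /= S0 !mulr0 add0r.
    rewrite [RHS]big_ord_recr /= amax // mul0r mulr0 addr0.
    by rewrite [RHS]big_ord_recr /= amax // mul0r mulr0 addr0.
rewrite -!big_split /=; apply: eq_bigr => j _.
rewrite /S /a /= exprS; set q := match _ with 0%N => _ | _ => _ end.
move: q (motzkin t m j) (motzkin t m j.+1) (sin _) => q u v s.
by rewrite /t; ring.
Qed.
End SineExpansion.

Section SineIntegral.
Variable R : realType.
Local Notation leb := (@lebesgue_measure R).

Lemma derivable_LRcontinuous (F : R -> R) a b :
  (forall x, derivable F x 1) -> derivable_oo_LRcontinuous F a b.
Proof.
move=> dF; have cF x : {for x, continuous F}.
  by apply: differentiable_continuous; apply/derivable1_diffP.
split=> //.
- by apply: cvg_at_right_filter; exact: cF.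
- by apply: cvg_at_left_filter; exact: cF.
Qed.

(** An antiderivative of [cos (j x)]. *)
Definition sine_primitive (j : nat) (x : R) : R :=
  if j is 0 then x else sin (j%:R * x) / j%:R.

Lemma is_derive_sine_primitive j (x : R) :
  is_derive x 1 (sine_primitive j) (cos (j%:R * x)).
Proof.
case: j => [|j].
  rewrite mul0r cos0; exact: is_derive_id.
set k : R := j.+1%:R; have k0 : k != 0 by rewrite pnatr_eq0.
rewrite (_ : sine_primitive j.+1 = k^-1 \*: (sin \o (k \*: (id : R -> R)))); last first.
  by apply/funext => y; rewrite /= mulrC.
apply: is_derive_eq.
by rewrite -[k%:A]/(k * 1) mulr1 -[_ *: _]/(_ * _) mulrCA mulVf ?mulr1.
Qed.

Definition sine_product_primitive j : R -> R :=
  2^-1 \*: (sine_primitive j - sine_primitive j.+2).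

Lemma is_derive_sine_product j (x : R) :
  is_derive x 1 (sine_product_primitive j) (sin x * sin (j.+1%:R * x)).
Proof.
have dG : is_derive x 1 (sine_product_primitive j)
    (2^-1 * (cos (j%:R * x) - cos (j.+2%:R * x))).
  by apply: is_deriveZ; apply: is_deriveB; exact: is_derive_sine_primitive.
apply: (is_derive_eq dG).
have -> : j.+2%:R * x = j.+1%:R * x + x by rewrite -natr1; ring.
have -> : j%:R * x = j.+1%:R * x - x by rewrite -natr1; ring.
by rewrite cosB cosD; field.
Qed.

Lemma sine_product_primitiveB j :
  sine_product_primitive j pi - sine_product_primitive j 0 =
  (j == 0%N)%:R * (pi / 2).
Proof.
have spi i : sin (i%:R * pi) = 0 :> R.
  elim: i => [|i IH]; first by rewrite mul0r sin0.
  by rewrite -natr1 mulrDl mul1r sinDpi IH oppr0.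
have FE x : sine_product_primitive j x =
    2^-1 * (sine_primitive j x - sine_primitive j.+2 x) by [].
rewrite !FE; case: j {FE} => [|j]; rewrite /sine_primitive !spi !mulr0 sin0 !mul0r.
  by rewrite !subr0 mulr0 subr0 mul1r mulrC.
by rewrite !subr0 mulr0 subr0.
Qed.

Lemma continuous_sin_nat j : continuous (fun x : R => sin (j%:R * x)).
Proof.
move=> x; apply: (@continuous_comp _ _ _ (fun y : R => j%:R * y) sin).
  exact: mulrl_continuous.
exact: continuous_sin.
Qed.

(** Orthogonality of the functions sin(jx) on the interval from 0 to pi: only the term with j = 0
    pairs [sin x] with itself. *)
Lemma integral_sine_products n (a : nat -> R) :
  (\int[leb]_(x in `[0%R, pi])
     (\sum_(j < n) a j * (sin x * sin (j.+1%:R * x)))%:E =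
   (\sum_(j < n) a j * ((nat_of_ord j == 0%N)%:R * (pi / 2)))%:E)%E.
Proof.
pose F : R -> R := \sum_(j < n) (a j \*: sine_product_primitive j).
have dF (x : R) : is_derive x 1 F (\sum_(j < n) a j * (sin x * sin (j.+1%:R * x))).
  apply: is_derive_sum => j; apply: is_deriveZ; exact: is_derive_sine_product.
have FE x : F x = \sum_(j < n) a j * sine_product_primitive j x.
  by rewrite /F fct_sumE.
rewrite (@continuous_FTC2 _ _ F); last 4 first.
- exact: pi_gt0.
- apply: continuous_subspaceT => x; apply: cvg_big => [|j _].
    exact: add_continuous.
  apply: cvgM; first exact: cvg_cst.
  by apply: cvgM; [exact: continuous_sin|exact: continuous_sin_nat].
- by apply: derivable_LRcontinuous => x; have := dF x => -[].
- by move=> x _; rewrite derive1E; have := dF x => -[].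
rewrite -EFinB !FE -sumrB; congr (_%:E); apply: eq_bigr => j _.
by rewrite -mulrBr sine_product_primitiveB.
Qed.
End SineIntegral.

Section FreePoissonMoments.
Variable R : realType.
Local Notation leb := (@lebesgue_measure R).
Variables (t : R) (ht : 0 < t <= 1).

(** The integrand once one power of x has cancelled the factor 1/x. It is continuous on the whole
    line, as the change of variables requires. *)
Definition semicircle_moment m (x : R) : R :=
  x ^+ m * (Num.sqrt (4 * t - (x - 1 - t) ^+ 2) / (2 * pi)).

Lemma free_poisson_pdf_exp m (x : R) : x ^+ m.+1 * free_poisson_pdf t x =
  if (1 - Num.sqrt t) ^+ 2 <= x <= (1 + Num.sqrt t) ^+ 2
  then semicircle_moment m x else 0.
Proof.
rewrite /free_poisson_pdf; case: ifP => _; last by rewrite mulr0.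
rewrite /semicircle_moment; have [->|x0] := eqVneq x 0.
  (* At 0 the root vanishes, because 4t - (1+t)^2 = -(1-t)^2, so the formula holds there also for m
     = 0. *)
  rewrite expr0n mul0r ler0_sqrtr ?mul0r ?mulr0 //.
  have := sqr_ge0 (1 - t); nra.
rewrite exprSr; have pi0 : (pi : R) != 0 by rewrite gt_eqF // pi_gt0.
move: (Num.sqrt _) (pi : R) pi0 (x ^+ m) => s p p0 y.
by field; rewrite p0 x0.
Qed.

Definition cos_param (theta : R) : R := 1 + t + 2 * Num.sqrt t * cos theta.

Lemma is_derive_cos_param (x : R) : is_derive x 1 cos_param (- (2 * Num.sqrt t * sin x)).
Proof.
have h : is_derive x 1 (cst (1 + t) + (2 * Num.sqrt t) \*: cos : R -> R)
    (0 + (2 * Num.sqrt t) * (- sin x)).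
  by apply: is_deriveD; apply: is_deriveZ.
by apply: (is_derive_eq h); rewrite add0r mulrN.
Qed.

Lemma derive1_cos_param : (derive1 cos_param) = fun x => - (2 * Num.sqrt t * sin x).
Proof.
by apply/funext => x; rewrite derive1E; have := is_derive_cos_param x => -[].
Qed.

Lemma integral_free_poisson_pdf m :
  (\int[leb]_x (x ^+ m.+1 * free_poisson_pdf t x)%:E = (t * motzkin t m 0)%:E)%E.
Proof.
have /andP[t0 t1] := ht; set r := Num.sqrt t.
have r0 : 0 < r by rewrite sqrtr_gt0.
have rr : r ^+ 2 = t by rewrite sqr_sqrtr // ltW.
have pi0 : (pi : R) != 0 by rewrite gt_eqF // pi_gt0.
have arc0 : cos_param 0 = (1 + r) ^+ 2 by rewrite /cos_param cos0 -/r -rr; ring.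
have arcpi : cos_param pi = (1 - r) ^+ 2 by rewrite /cos_param cospi -/r -rr; ring.
transitivity (\int[leb]_(x in `[cos_param pi, cos_param 0]) (semicircle_moment m x)%:E)%E.
  rewrite [RHS]integral_mkcond; apply: eq_integral => x _.
  rewrite patchE free_poisson_pdf_exp arc0 arcpi -/r.
  rewrite mem_setE in_itv /=.
  by case: ifP.
have carc' : continuous (derive1 cos_param).
  rewrite derive1_cos_param => x; apply: cvgN; apply: cvgM; first exact: cvg_cst.
  exact: continuous_sin.
rewrite integration_by_substitution_decreasing; last 7 first.
- exact: pi_ge0.
- move=> x y x0 y0 xy; rewrite /cos_param ltrD2l ltr_pM2l ?mulr_gt0 //.
  by rewrite ltr_cos.
- by move=> x _; exact: carc'.
- by apply/cvg_ex; exists ((derive1 cos_param) 0); apply: cvg_at_right_filter; exact: carc'.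
- by apply/cvg_ex; exists ((derive1 cos_param) pi); apply: cvg_at_left_filter; exact: carc'.
- by apply: derivable_LRcontinuous => x; have := is_derive_cos_param x => -[].
- apply: continuous_subspaceT => x; apply: cvgM; first exact: exprn_continuous.
  apply: cvgM; last exact: cvg_cst.
  apply: (@continuous_comp _ _ _ (fun y : R => 4 * t - (y - 1 - t) ^+ 2) Num.sqrt).
    apply: cvgB; first exact: cvg_cst.
    apply: (@continuous_comp _ _ _ (fun y : R => y - 1 - t) (@GRing.exp R ^~ 2)).
      by apply: cvgB; [apply: cvgB; [exact: cvg_id|exact: cvg_cst]|exact: cvg_cst].
    exact: exprn_continuous.
  exact: sqrt_continuous.
(* The root and the derivative of [cos_param] each contribute 2 r sin x, hence the constant 2t/pi.
   One sine feeds [sine_expansion]; the other remains for orthogonality. *)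
transitivity (\int[leb]_(x in `[0%R, pi]) (\sum_(j < m.+1)
    (2 * t / pi * (r ^+ j * motzkin t m j)) * (sin x * sin (j.+1%:R * x)))%:E)%E.
  apply: eq_integral => x; rewrite inE /= in_itv /= => xpi.
  congr (_%:E); rewrite derive1_cos_param.
  transitivity (semicircle_moment m (cos_param x) * - - (2 * r * sin x)); first by [].
  rewrite opprK /semicircle_moment.
  have s2 : sin x ^+ 2 = 1 - cos x ^+ 2 by rewrite -(cos2Dsin2 x); ring.
  have -> : 4 * t - (cos_param x - 1 - t) ^+ 2 = (2 * r * sin x) ^+ 2.
    by rewrite [RHS]exprMn s2 /cos_param -/r -rr; ring.
  rewrite sqrtr_sqr ger0_norm; last by rewrite !mulr_ge0 ?sin_ge0_pi // ltW.
  have := sine_expansion r x m; rewrite rr => e.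
  transitivity (2 * t / pi * (sin x * (cos_param x ^+ m * sin x))).
    rewrite -{1}rr; move: (pi : R) pi0 (cos_param x ^+ m) (sin x) => p p0 y z.
    by field; rewrite p0.
  rewrite e mulr_sumr mulr_sumr; apply: eq_bigr => j _; ring.
rewrite (integral_sine_products _ (fun j => 2 * t / pi * (r ^+ j * motzkin t m j))).
congr (_%:E); rewrite big_ord_recl big1 /= ?addr0; last first.
  by move=> j _; rewrite mul0r mulr0.
rewrite expr0; move: (pi : R) pi0 (motzkin _ _ _) => p p0 y.
by field; rewrite p0.
Qed.

Lemma free_poisson_moment k : (0 < k)%N ->
  (\int[free_poisson ht]_x (x ^+ k)%:E = (narayana t k)%:E)%E.
Proof.
case: k => // m _; rewrite integral_free_poisson_exp.
exact: integral_free_poisson_pdf.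
Qed.
End FreePoissonMoments.

(** * Reality of the moments and passage to the limit *)

Section StateReal.
Variables (R : realType) (A : cstarType R).

(* [4 y = (y + 1)^2 - (y - 1)^2] *)
Lemma state_real (h : A -> R[i]) y : is_state h -> star y = y ->
  h y = (complex.Re (h y))%:C.
Proof.
move=> [hl h0 _] yy.
have e : y = 4^-1 *: (star (y + 1) * (y + 1)) + (- 4^-1) *: (star (y - 1) * (y - 1)).
  rewrite !starD starN star1 yy scaleNr -scalerBr.
  have -> : (y + 1) * (y + 1) - (y - 1) * (y - 1) = y *+ 4.
    rewrite -!expr2 sqrrD1 sqrrB1 opprD addrACA subrr addr0 opprB addrC addrA.
    by rewrite subrK -mulrnDr.
  by rewrite -(scaler_nat 4 y) scalerA mulVf ?scale1r // pnatr_eq0.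
rewrite RRe_real // e hl.
rewrite (raw_scalarZ _ _ hl) rpredD // rpredM //.
- by rewrite rpredV realn.
- exact/ger0_real/h0.
- by rewrite rpredN rpredV realn.
- exact/ger0_real/h0.
Qed.

Lemma star_truncated_trace n (u : 'M[A]_n) s : magic_unitary u ->
  star (truncated_trace u s) = truncated_trace u s.
Proof.
move=> [pr _ _ _ _]; rewrite /truncated_trace (big_morph _ (@starD R A) (star0 A)).
by apply: eq_bigr => i _; case: (pr i i).
Qed.
End StateReal.

Lemma cvg_real_complex (R : realType) (f : nat -> R) (l : R) :
  f @ \oo --> l ->
  (fun n => (f n)%:C : (R[i] : numFieldType)) @ \oo --> (l%:C : (R[i] : numFieldType)).
Proof.
move=> /cvgrPdist_lt fl; apply/cvgrPdist_lt => e e0.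
have eE : e = (complex.Re e)%:C by rewrite RRe_real // gtr0_real.
have re0 : 0 < complex.Re e by move: e0; rewrite {1}eE ltcR.
apply: filterS (fl _ re0) => n; rewrite -ltcR -eE.
by rewrite -rmorphB /= normc_def /= expr0n addr0 sqrtr_sqr.
Qed.

Lemma littleo_ratio (R : realType) (s : nat -> nat) (t : R) :
  (fun n : nat => (s n)%:R - t * n%:R : R) =o_\oo (fun n : nat => n%:R : R) ->
  (fun n => ratio R (s n) n) @ \oo --> t.
Proof.
move=> /eqoP so; apply/cvgrPdist_le => e e0; near=> n.
have n0 : 0 < n%:R :> R by rewrite ltr0n; near: n; exists 1%N.
rewrite distrC /ratio -(ler_pM2r n0) -{2}[n%:R]ger0_norm ?ler0n // -normrM.
rewrite mulrBl divfK ?gt_eqF // -[X in _ <= e * X]ger0_norm ?ler0n //.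
by near: n; apply: so.
Unshelve. all: by end_near. Qed.

Theorem theorem4p1 (R : realType)
    (A AA : nat -> cstarType R) (u : forall n : nat, 'M[A n]_n)
    (tens : forall n : nat, A n -> A n -> AA n)
    (Delta : forall n : nat, A n -> AA n)
    (h : forall n : nat, A n -> R[i])
    (Au : forall n : nat, (4 <= n)%N -> is_As (u n))
    (tensP : forall n : nat, (4 <= n)%N -> is_cstar_tensor (tens n))
    (DeltaP : forall n : nat, (4 <= n)%N ->
       is_comultiplication (tens n) (u n) (Delta n))
    (haar : forall n : nat, (4 <= n)%N ->
       is_haar_state (tens n) (Delta n) (h n)) :
  (forall s : nat -> nat,
     (forall n : nat, (4 <= n)%N -> (1 <= s n <= n)%N) ->
     ((s n)%:R / n%:R : R) @[n --> \oo] --> (0 : R) ->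
     forall k : nat, (1 <= k)%N ->
       exists2 eps : nat -> R, eps @ \oo --> (0 : R) &
         forall n : nat, (4 <= n)%N ->
           h n (truncated_trace (u n) (s n) ^+ k) =
           ((s n)%:R / n%:R * (1 + eps n))%:C) /\
  (forall (t : R) (ht : 0 < t <= 1) (s : nat -> nat),
     (forall n : nat, (4 <= n)%N -> (1 <= s n <= n)%N) ->
     (fun n : nat => (s n)%:R - t * n%:R : R) =o_\oo (fun n : nat => n%:R : R) ->
     forall k : nat, (1 <= k)%N ->
       ((h n (truncated_trace (u n) (s n) ^+ k) : (R[i] : numFieldType))
          @[n --> \oo] --> ((\sum_(p in NC k) t ^+ #|p|)%:C : (R[i] : numFieldType))) /\
       (\int[free_poisson ht]_x (x ^+ k)%:E
          = (\sum_(p in NC k) t ^+ #|p|)%:E)%E).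
Proof.
have moment (s : nat -> nat) k : (forall n, (4 <= n)%N -> (1 <= s n <= n)%N) ->
    \forall n \near \oo, h n (truncated_trace (u n) (s n) ^+ k) =
      (\tr (invmx (gram_mx k R n) *m gram_mx k R (s n)))%:C.
  move=> sn; near=> n.
  have n4 : (4 <= n)%N by near: n; exists 4%N.
  have kn : (k + 2 <= n)%N by near: n; exists (k + 2)%N.
  have [//|_ Gu _] := near (@gram_ratio_near R k s) n.
  have /andP[_ sln] := sn n n4.
  exact: (haar_moment_trace (Au n n4) (tensP n n4) (DeltaP n n4) (haar n n4) sln kn Gu).
split=> [s sn s0 k k1|t ht s sn so k k1].
(* The error term is forced by the required identity. That identity holds for every [n >= 4], not
   only for large [n], because the moment of a self-adjoint element is real and [s n / n] is
   nonzero. *)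
- pose m n := complex.Re (h n (truncated_trace (u n) (s n) ^+ k)).
  exists (fun n => (ratio R (s n) n)^-1 * m n - 1).
    rewrite -(subrr (1 : R)); apply: cvgB; last exact: cvg_cst.
    apply: (@cvg_trans _ ((fun n => (ratio R (s n) n)^-1 *
        \tr (invmx (gram_mx k R n) *m gram_mx k R (s n))) @ \oo)).
      apply: near_eq_cvg; near=> n.
      by rewrite /m (near (moment s k sn) n).
    apply: cvg_trace_projection => //; near=> n.
    have /sn/andP[//] : (4 <= n)%N by near: n; exists 4%N.
  move=> n n4; rewrite addrC subrK.
  have /andP[sn0 snn] := sn n n4.
  have r0 : ratio R (s n) n != 0.
    by rewrite mulf_neq0 ?invr_eq0 // pnatr_eq0 -lt0n // (leq_trans sn0).
  rewrite mulrA -/(ratio R (s n) n) mulfV // mul1r.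
  have [[_ _ _ _ _] _] := Au n n4.
  have [st _ _] := haar n n4.
  apply: state_real st _; apply/star_exp/star_truncated_trace.
  by have [] := Au n n4.
- rewrite (sum_NC t k); split; last exact: free_poisson_moment.
  apply: (@cvg_trans _ ((fun n => (\tr (invmx (gram_mx k R n) *m gram_mx k R (s n)))%:C
      : (R[i] : numFieldType)) @ \oo)).
    by apply: near_eq_cvg; apply: filterS (moment s k sn) => n ->.
  apply: cvg_real_complex; rewrite -(sum_NC t k).
  apply: cvg_trace_free_poisson; first by case/andP: ht => /gt_eqF ->.
  exact: littleo_ratio.
Unshelve. all: by end_near. Qed.
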